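(* For every integer $n\ge 16$ one has $\kappa_2(n)\ge 6$. For every odd integer $n\ge 17$ one has $\kappa_2(n)\ge 7$. Both bounds are attained: $\kappa_2(16)=6$ and $\kappa_2(17)=\kappa_2(19)=\kappa_2(21)=7$. The initial order $16$ in the first assertion is best possible, since $\kappa_2(15)=5$.
   Context: For a real symmetric matrix $A=(a_{ij})$, $A^{\circ 2}=(a_{ij}^2)$ denotes its entrywise square and $n_+(A)$ denotes the number of positive eigenvalues of $A$, counted with multiplicity. For an integer $n\ge1$, $\kappa_2(n)$ is the minimum of $n_+(H)$ over all real symmetric circulant $n\times n$ matrices $H$ with (strictly) positive entries such that $H^{\circ 2}$ is positive definite. *)

(* Defs.v *)
From mathcomp Require Import all_boot all_order all_algebra.
From mathcomp Require Import boolp reals.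
From mathcomp Require polyrcf.

Set Implicit Arguments.
Unset Strict Implicit.
Unset Printing Implicit Defensive.

Import Order.TTheory GRing.Theory Num.Theory.
Local Open Scope ring_scope.

Section Defs.
Variables (R : realType) (n : nat).
Implicit Types A H : 'M[R]_n.

(* A i j = c_((j - i) mod n); the offset n avoids truncated subtraction, and
   only the values of c below n matter. *)
Definition circulant A : Prop :=
  exists c : nat -> R, forall i j : 'I_n, A i j = c ((j + n - i) %% n)%N.

Definition entrywise_sq A : 'M[R]_n := map_mx (fun a => a ^+ 2) A.

Definition posdef A : Prop :=
  A^T = A /\ forall x : 'cV[R]_n, x != 0 -> 0 < (x^T *m A *m x) 0 0.

(* rootsR lists each distinct real root once, and mup is the multiplicity of a
   root of the characteristic polynomial. *)
Definition npos A : nat :=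
  (\sum_(x <- polyrcf.rootsR (char_poly A) | (0 < x)%R)
     mup x (char_poly A))%N.

Definition kappa2_admissible H : Prop :=
  [/\ H^T = H, circulant H, forall i j, 0 < H i j & posdef (entrywise_sq H)].

Definition kappa2_value : pred nat :=
  fun k => `[< exists H, kappa2_admissible H /\ npos H = k >].

(* Witness: H = I + J, with J the all-ones matrix. *)
Lemma kappa2_value_ex : exists k, kappa2_value k.
Proof.
pose H : 'M[R]_n := \matrix_(i, j) (1 + (i == j)%:R).
exists (npos H); apply/asboolP; exists H; split=> //; split.
- by apply/matrixP => i j; rewrite !mxE eq_sym.
- exists (fun k => 1 + (k == 0%N)%:R) => i j; rewrite mxE; congr (1 + _%:R).
  congr nat_of_bool; apply/eqP/eqP => [->|]; first by rewrite addKn modnn.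
  have [ltin ltjn] := (ltn_ord i, ltn_ord j).
  have [leij|ltji] := leqP i j.
    rewrite addnC -addnBA // modnDl modn_small; last first.
      exact: leq_ltn_trans (leq_subr _ _) ltjn.
    by move/eqP; rewrite subn_eq0 => leji; apply/val_inj/anti_leq/andP.
  rewrite modn_small; first by move/eqP; rewrite subn_eq0 leqNgt ltn_addl.
  by rewrite ltn_subLR ?ltn_add2r // ltnW // ltn_addl.
- by move=> i j; rewrite mxE ltr_pwDl.
split=> [|x x_neq0]; first by apply/matrixP => i j; rewrite !mxE eq_sym.
have -> : (x^T *m entrywise_sq H *m x) 0 0 =
    (\sum_i x i 0) ^+ 2 + \sum_i 3%:R * x i 0 ^+ 2.
  rewrite mxE expr2 mulr_sumr -big_split /=; apply: eq_bigr => j _.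
  have -> : (x^T *m entrywise_sq H) 0 j = \sum_i x i 0 + 3%:R * x j 0.
    rewrite mxE (eq_bigr (fun i => x i 0 + 3%:R * ((i == j)%:R * x i 0))).
      rewrite big_split -mulr_sumr /= [X in _ + 3%:R * X](bigD1 j) //= eqxx.
      rewrite mul1r [X in _ + 3%:R * (_ + X)]big1 ?addr0 // => i /negPf->.
      by rewrite mul0r.
    move=> i _; rewrite !mxE; case: eqP => _; last first.
      by rewrite addr0 expr1n mul0r mulr0 addr0 mulr1.
    by rewrite -[1 + true%:R]/2%:R -natrX mulrC mul1r -[X in X + _]mul1r -mulrDl -mulrS.
  by rewrite mulrDl -mulrA -expr2.
have [i xi_neq0] : exists i, x i 0 != 0.
  apply/existsP; apply: contraNT x_neq0; rewrite negb_exists => /forallP x0.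
  by apply/eqP/matrixP => i j; rewrite mxE ord1; apply/eqP/negPn/x0.
rewrite ltr_wpDl ?sqr_ge0 // (bigD1 i) //= ltr_wpDr //.
  by rewrite sumr_ge0 // => j _; rewrite mulr_ge0 ?sqr_ge0 ?ler0n.
by rewrite mulr_gt0 ?ltr0n // exprn_even_gt0.
Qed.

Definition kappa2 : nat := ex_minn kappa2_value_ex.

End Defs.

Arguments kappa2 : clear implicits.

(* Main.v *)
(* Write the eigenvalues of a circulant H as l : Z/n -> R, the transform of its
   first row c, normalised by l 0 = 1. The eigenvalues of the entrywise square
   are a positive multiple of the convolution l * l, so admissibility says that
   the transform of l is positive and that l * l > 0. Since c^2 is a positive
   definite function, c is maximal at 0, whence (l * l)(0) <= sum l and the
   negative part m of l has total mass at most sum_P l (1 - l), where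
   P = {l > 0}.

   The set P is symmetric and contains 0, so at most five positive eigenvalues
   means P = {0, a, -a, b, -b}. Summing l * l > 0 over a set E disjoint from P
   bounds the products m_i m_j with i + j in E from below by products m_j l_i
   with j in E - P. Taking E to be the complement of P + P, possibly with some of
   2a, 2b, a + b, a - b added, and using the mass bound gives polynomial
   inequalities in the values of l at a, b, 2a, 2b, a + b, a - b, which depend
   only on the relations s a + t b = 0 with |s| + |t| <= 6. For n <= 36 these
   relation patterns are enumerated; for n > 36 all such relations are multiples
   of a single one, because the determinant of two of them is killed by a
   generator of Z/n and has absolute value at most 36. Each pattern yields a
   contradiction. For odd n the cardinality of P is odd, which improves 6 to 7.

   Conversely, the autocorrelation of an integer sequence g plus the unit mass
   at 0 has positive transform, so such an l defines an admissible matrix as soon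
   as l * l > 0, a finite integer computation. *)
Require Import Defs.
From Stdlib Require Import ZArith.
From mathcomp Require Import all_boot all_order all_algebra.
From mathcomp Require Import cyclic separable cyclotomic complex polyrcf boolp reals.
From mathcomp Require Import ring lra zify ssrZ.

Set Implicit Arguments.
Unset Strict Implicit.
Unset Printing Implicit Defensive.

Import Order.TTheory GRing.Theory Num.Theory.
Local Open Scope ring_scope.

(** * Convolution inequalities *)

Section Convolution.
Variables (R : realFieldType) (G : finZmodType).
Implicit Types (l : G -> R) (E T : {set G}) (k : G).

Definition conv l k : R := \sum_j l j * l (k - j).
Definition possupp l : {set G} := [set k | 0 < l k].
Definition negpart l k : R := Num.max 0 (- l k).

Lemma negpart_ge0 l k : 0 <= negpart l k.
Proof. by rewrite le_max lexx. Qed.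

Lemma negpart_possupp l k : k \in possupp l -> negpart l k = 0.
Proof. by rewrite inE => h; apply: max_l; rewrite oppr_le0 ltW. Qed.

Lemma negpart_off l k : k \notin possupp l -> l k = - negpart l k.
Proof. by rewrite inE -leNgt => h; rewrite /negpart max_r ?opprK // oppr_ge0. Qed.

Lemma sum_conv l E :
  \sum_(k in E) conv l k = \sum_i \sum_j l i * l j * (i + j \in E)%:R.
Proof.
rewrite exchange_big /=; apply: eq_bigr => i _.
rewrite (reindex_inj (addrI i)) /= big_mkcond /=; apply: eq_bigr => j _.
by rewrite addrAC subrr add0r; case: ifP => _; rewrite ?mulr1 ?mulr0.
Qed.

(** Splitting the sum of [l] by sign and discarding the squares outside [possupp l] gives the
    bound. *)
Lemma neg_mass_le l (c := \sum_k l k) : \sum_k l k ^+ 2 <= c ->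
  \sum_k negpart l k <= \sum_(k in possupp l) l k * (1 - l k).
Proof.
move=> h; pose Q k := k \in possupp l.
have e1 : c = \sum_(k | Q k) l k - \sum_k negpart l k.
  rewrite /c (bigID Q) /=; congr (_ + _).
  rewrite [in RHS](bigID Q) /= [X in - (X + _)]big1 ?add0r => [|k /negpart_possupp//].
  by rewrite -sumrN; apply: eq_bigr => k /negpart_off.
have e2 : \sum_(k | Q k) l k ^+ 2 <= \sum_k l k ^+ 2.
  by rewrite [leRHS](bigID Q) /= lerDl sumr_ge0 // => k _; apply: sqr_ge0.
have -> : \sum_(k in possupp l) l k * (1 - l k) =
    \sum_(k | Q k) l k - \sum_(k | Q k) l k ^+ 2.
  by rewrite -sumrB; apply: eq_bigr => k _; rewrite mulrBr mulr1.
lra.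
Qed.

(* A class in [T] may be dropped: the term i = 0 makes its cross products with
   [P] at least its own mass, while its products with [m] are at most its mass
   because [m] has total mass at most 1. *)
Lemma conv_ineq l E T (P := possupp l) (m := negpart l) :
  l 0 = 1 -> \sum_k m k <= 1 -> (forall k, 0 < conv l k) ->
  E != set0 -> T \subset E -> [disjoint E & P] ->
  0 < \sum_(i in P) \sum_(j in P) l i * l j * (i + j \in E)%:R
      + \sum_(i in ~: (P :|: T)) \sum_(j in ~: (P :|: T))
          m i * m j * (i + j \in E)%:R
      - 2 * \sum_(j in ~: (P :|: T)) \sum_(i in P) m j * l i * (j + i \in E)%:R.
Proof.
move=> l0 M1 cv E0 TE EP.
have m0 k : 0 <= m k by apply: negpart_ge0.
have mP k : k \in P -> m k = 0 by apply: negpart_possupp.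
have mD k : k \notin P -> l k = - m k by apply: negpart_off.
have : 0 < \sum_(k in E) conv l k.
  have /set0Pn[k0 k0E] := E0.
  by rewrite (bigD1 k0) //= ltr_pwDl // sumr_ge0 // => k _; apply/ltW.
rewrite sum_conv => h; apply: lt_le_trans h _.
pose I i j : R := (i + j \in E)%:R.
have I0 i j : 0 <= I i j by rewrite /I ler0n.
have I1 i j : I i j <= 1 by rewrite /I lern1 leq_b1.
rewrite (bigID (mem P)) /=.
have -> : \sum_(i in P) \sum_j l i * l j * (i + j \in E)%:R =
    \sum_(i in P) \sum_(j in P) l i * l j * (i + j \in E)%:R
    - \sum_(j in ~: P) \sum_(i in P) m j * l i * (j + i \in E)%:R.
  rewrite [X in _ - X]exchange_big /= -sumrB; apply: eq_bigr => i iP.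
  rewrite (bigID (mem P)) /=; congr (_ + _); rewrite -sumrN.
  apply: eq_big => [j|j jP]; first by rewrite in_setC.
  by rewrite (mD j) // [j + i]addrC; ring.
have -> : \sum_(i | i \notin P) \sum_j l i * l j * (i + j \in E)%:R =
    \sum_(i in ~: P) \sum_(j in ~: P) m i * m j * (i + j \in E)%:R
    - \sum_(j in ~: P) \sum_(i in P) m j * l i * (j + i \in E)%:R.
  rewrite -sumrB; apply: eq_big => [j|i iP]; first by rewrite in_setC.
  rewrite (bigID (mem P)) /= addrC; congr (_ + _).
    apply: eq_big => [j|j jP]; first by rewrite in_setC.
    by rewrite (mD i) // (mD j) //; ring.
  by rewrite -sumrN; apply: eq_bigr => j jP; rewrite (mD i) //; ring.
have TP j : j \in T -> j \notin P.
  by move=> jT; have := disjointFr EP (subsetP TE _ jT) => ->.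
have splitQ (F : G -> R) : \sum_(j in ~: P) F j =
    \sum_(j in T) F j + \sum_(j in ~: (P :|: T)) F j.
  rewrite (bigID (mem T)) /=; congr (_ + _); apply: eq_bigl => j.
    by rewrite in_setC; case: (boolP (j \in T)) => [/TP ->|]; rewrite ?andbF.
  by rewrite !in_setC in_setU negb_or.
pose MT := \sum_(j in T) m j.
have MT0 : 0 <= MT by apply: sumr_ge0.
have Q1 : MT <= \sum_(j in T) \sum_(i in P) m j * l i * (j + i \in E)%:R.
  apply: ler_sum => j jT; rewrite (bigD1 0) ?inE ?l0 //= addr0 mulr1.
  rewrite (subsetP TE _ jT) mulr1 lerDl; apply: sumr_ge0 => i /andP[iP _].
  by rewrite -mulrA !mulr_ge0 //; move: iP; rewrite inE => /ltW.
(* Restricting both indices to the complement of [T] loses the pairs whose first or second index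
   lies in [T]. Each of these two families weighs at most [MT], and [Q1], which enters with factor
   2, pays for both. *)
have Q2 : \sum_(i in ~: P) \sum_(j in ~: P) m i * m j * (i + j \in E)%:R
    <= \sum_(i in ~: (P :|: T)) \sum_(j in ~: (P :|: T))
          m i * m j * (i + j \in E)%:R + 2 * MT.
  have bnd i (A : {set G}) :
      \sum_(j in A) m i * m j * (i + j \in E)%:R <= m i.
    apply: (@le_trans _ _ (\sum_(j in A) m i * m j)).
      by apply: ler_sum => j _; rewrite ler_piMr ?mulr_ge0 ?I1.
    rewrite -mulr_sumr ler_piMr //; apply: le_trans M1.
    by rewrite [leRHS](bigID (mem A)) /= lerDl sumr_ge0.
  rewrite splitQ [leLHS]addrC.
  have -> : \sum_(i in ~: (P :|: T)) \sum_(j in ~: P) m i * m j * (i + j \in E)%:R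
     = \sum_(i in ~: (P :|: T)) \sum_(j in ~: (P :|: T)) m i * m j * (i + j \in E)%:R
      + \sum_(j in T) \sum_(i in ~: (P :|: T)) m j * m i * (j + i \in E)%:R.
    rewrite [X in _ + X]exchange_big /= -big_split /=; apply: eq_bigr => i _.
    rewrite splitQ addrC; congr (_ + _); apply: eq_bigr => j _.
    by rewrite [j + i]addrC [m j * _]mulrC.
  have b1 : \sum_(j in T) \sum_(i in ~: (P :|: T)) m j * m i * (j + i \in E)%:R <= MT.
    by apply: ler_sum => j _; apply: bnd.
  have b2 : \sum_(i in T) \sum_(j in ~: P) m i * m j * (i + j \in E)%:R <= MT.
    by apply: ler_sum => j _; apply: bnd.
  lra.
rewrite [\sum_(j in ~: P) \sum_(i in P) _]splitQ.
lra.
Qed.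

End Convolution.

(** * Relation tables *)

(* The code (s, t) stands for the group element s a + t b, and [rel z] tells
   whether the element coded by z is 0. *)
Definition code := (int * int)%type.
Definition cadd (z w : code) : code := (z.1 + w.1, z.2 + w.2).
Definition csub (z w : code) : code := (z.1 - w.1, z.2 - w.2).
Definition cnorm (z : code) : nat := (`|z.1| + `|z.2|)%N.

Lemma cnorm_add z w : (cnorm (cadd z w) <= cnorm z + cnorm w)%N.
Proof. by rewrite /cnorm /=; lia. Qed.

Lemma cnorm_sub z w : (cnorm (csub z w) <= cnorm z + cnorm w)%N.
Proof. by rewrite /cnorm /=; lia. Qed.

Section Table.
Variable rel : code -> bool.
Definition ceq z w := rel (csub z w).

(** A code is dropped when a later one denotes the same element, so the last representative
    survives. The order of the code lists therefore decides which tag an element keeps; 0 always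
    keeps tag 0. *)
Fixpoint cundup (s : seq (code * nat)) :=
  if s is z :: s' then
    let r := cundup s' in if has (fun w => ceq z.1 w.1) r then r else z :: r
  else [::].

(* The tags number the orbits under negation: 0, a, b here, and 2a, 2b, a + b,
   a - b in [dist_codes]. They index the values of l, respectively of m. *)
Definition supp_codes : seq (code * nat) :=
  [:: ((0, -1), 2%N); ((0, 1), 2%N); ((-1, 0), 1%N); ((1, 0), 1%N); ((0, 0), 0%N)].
Definition sum_codes : seq code :=
  [:: (0, 0); (1, 0); (-1, 0); (0, 1); (0, -1); (2, 0); (-2, 0);
      (0, 2); (0, -2); (1, 1); (-1, -1); (1, -1); (-1, 1)].
Definition dist_codes : seq (code * nat) :=
  [:: ((-1, 1), 3%N); ((1, -1), 3%N); ((-1, -1), 2%N); ((1, 1), 2%N);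
      ((0, -2), 1%N); ((0, 2), 1%N); ((-2, 0), 0%N); ((2, 0), 0%N)].

(** [LP] enumerates P, and [LD] enumerates P + P without P. Classes shrink or vanish when relations
    make codes coincide. *)
Definition LP := cundup supp_codes.
Definition LD :=
  cundup [seq d <- dist_codes | ~~ has (fun u => ceq d.1 u.1) supp_codes].
(** Membership in the test set: the complement of P + P together with the classes of [D] selected by
    [F]. [D] is a parameter so that a check computes [LD] only once. *)
Definition offsum_in (D : seq (code * nat)) (F : seq nat) (z : code) : bool :=
  ~~ has (ceq z) sum_codes || has (fun d => (d.2 \in F) && ceq z d.1) D.
Definition incidences_in D F (s t : seq (code * nat)) : seq (nat * nat) :=
  [seq (q.1.2, q.2.2) | q <- [seq (u, v) | u <- s, v <- t]
                      & offsum_in D F (cadd q.1.1 q.2.1)].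
Definition offsum := offsum_in LD.
Definition incidences := incidences_in LD.
Definition LA F := incidences F LD LD.
Definition LN F := incidences F LD LP.
Definition LC F := incidences F LP LP.
Definition LE := [seq d.2 | d <- LD].
Definition LW := [seq u.2 | u <- LP].

(** * Interpretation of the codes in a group *)

Section Soundness.
Variables (R : realFieldType) (G : finZmodType) (l : G -> R) (a b : G).
Definition cval (z : code) : G := a *~ z.1 + b *~ z.2.
(** Norm 6 suffices because a sum of two codes of norm at most 2 is compared with a third code of
    norm at most 2. *)
Hypothesis relP : forall z, (cnorm z <= 6)%N -> rel z = (cval z == 0).
Hypotheses (leven : forall k, l (- k) = l k) (l0 : l 0 = 1).
Hypothesis lmax : forall k, l k <= 1.
Hypothesis lsq : \sum_k l k ^+ 2 <= \sum_k l k.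
Hypothesis lconv : forall k, 0 < conv l k.
Hypothesis lsupp : possupp l = [set 0; a; - a; b; - b].

Let P := possupp l.
Let m := negpart l.

Lemma cval_add z w : cval (cadd z w) = cval z + cval w.
Proof. by rewrite /cval /= !mulrzDr addrACA. Qed.

Lemma cval_sub z w : cval (csub z w) = cval z - cval w.
Proof. by rewrite /cval /= !mulrzBr opprD addrACA. Qed.

Lemma ceqE z w : (cnorm z + cnorm w <= 6)%N -> ceq z w = (cval z == cval w).
Proof.
move=> h; rewrite /ceq relP ?cval_sub ?subr_eq0 //.
exact: leq_trans (cnorm_sub _ _) h.
Qed.

Definition small k (s : seq (code * nat)) := all (fun z => (cnorm z.1 <= k)%N) s.

Lemma cundup_sub s : {subset cundup s <= s}.
Proof.
elim: s => //= z s IH u; case: ifP => _ /=; rewrite !in_cons.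
  by move=> /IH ->; rewrite orbT.
by case/orP => [->//|/IH ->]; rewrite orbT.
Qed.

Lemma mem_cundup k s : (k <= 3)%N -> small k s ->
  [seq cval z.1 | z <- cundup s] =i [seq cval z.1 | z <- s].
Proof.
move=> k3; elim: s => //= z s IH /andP[zk sk] g; rewrite in_cons -IH //.
case: ifP => [/hasP[w wr]|_]; last by rewrite in_cons.
rewrite ceqE; last first.
  by have /allP/(_ _ (cundup_sub wr)) /= := sk; lia.
move=> /eqP e; case: eqP => //= ->; rewrite e; apply/mapP; by exists w.
Qed.

Lemma uniq_cundup k s : (k <= 3)%N -> small k s -> uniq [seq cval z.1 | z <- cundup s].
Proof.
move=> k3; elim: s => //= z s IH /andP[zk sk].
case: ifP => [_|/negbT/hasPn h] /=; rewrite IH // andbT.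
apply/negP => /mapP[w wr e]; have := h _ wr; rewrite ceqE ?e ?eqxx //.
by have /allP/(_ _ (cundup_sub wr)) /= := sk; lia.
Qed.

Lemma small_supp : small 1 supp_codes. Proof. by []. Qed.

Lemma small_dist Q : small 2 [seq d <- dist_codes | Q d].
Proof. by apply/allP => d; rewrite mem_filter => /andP[_]; apply/allP: d. Qed.

Lemma small_LP u : u \in LP -> (cnorm u.1 <= 1)%N.
Proof. by move/cundup_sub; apply/allP: u. Qed.

Lemma small_LD d : d \in LD -> (cnorm d.1 <= 2)%N.
Proof. by move/cundup_sub; apply/allP: d; apply: small_dist. Qed.

Lemma mem_supp g : (g \in [seq cval u.1 | u <- supp_codes]) = (g \in P).
Proof.
rewrite /P lsupp !inE /= /cval /= !mulr0z !mulr1z !mulrNz !mulr1z !addr0 !add0r.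
by do ![case: eqP => _ //=].
Qed.

Lemma mem_LP g : (g \in [seq cval u.1 | u <- LP]) = (g \in P).
Proof. by rewrite (mem_cundup (k := 1)) // mem_supp. Qed.

Lemma sum_P (V : nmodType) (f : G -> V) :
  \sum_(g in P) f g = \sum_(u <- LP) f (cval u.1).
Proof.
rewrite -(big_map (fun u => cval u.1) xpredT f) big_uniq /=.
  by apply: eq_bigl => g; rewrite mem_LP.
exact: (uniq_cundup (k := 1)).
Qed.

Lemma mem_sum_codes g :
  (g \in [seq cval z | z <- sum_codes]) =
  [exists i in P, [exists j in P, g == i + j]].
Proof.
apply/idP/idP.
  move=> /mapP[z zs ->].
  pose ok (w : code) := has (fun u : code * nat => has (fun v : code * nat =>
     w == cadd u.1 v.1) supp_codes) supp_codes.
  have /hasP[u us /hasP[v vs /eqP ->]] : ok z by apply: (allP (_ : all ok sum_codes)).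
  apply/existsP; exists (cval u.1); rewrite -mem_supp (map_f (fun u => cval u.1)) //=.
  by apply/existsP; exists (cval v.1); rewrite -mem_supp (map_f (fun u => cval u.1)) //= cval_add.
move=> /existsP[i /andP[]]; rewrite -mem_supp => /mapP[u us ->].
move=> /existsP[j /andP[]]; rewrite -mem_supp => /mapP[v vs ->] /eqP ->.
rewrite -cval_add; apply/map_f; move: v vs; apply/allP; move: u us; apply/allP.
by [].
Qed.

Definition far : {set G} := [set g | g \notin [seq cval z | z <- sum_codes]].
Definition near_classes (F : seq nat) : {set G} :=
  [set g | has (fun d : code * nat => (d.2 \in F) && (g == cval d.1)) LD].
Definition target F := far :|: near_classes F.

Lemma offsumE F z : (cnorm z <= 4)%N -> offsum F z = (cval z \in target F).
Proof.
move=> z4; rewrite /offsum /offsum_in /target in_setU 2!in_set; congr (~~ _ || _).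
  elim: sum_codes (isT : all (fun w => cnorm w <= 2)%N sum_codes) => //= w s IH /andP[w2 /IH ->].
  by rewrite in_cons ceqE //; lia.
apply: eq_in_has => d /small_LD d2.
by rewrite ceqE //; apply: leq_trans (leq_add z4 d2) _.
Qed.

(** Since 0 lies in P, removing P and [far] from the group leaves P + P without P. Every code of P +
    P occurs in [supp_codes] or in [dist_codes]. *)
Lemma mem_LD g : (g \in [seq cval d.1 | d <- LD]) = (g \in ~: (P :|: far)).
Proof.
rewrite (mem_cundup (k := 2)) ?small_dist // in_setC in_setU negb_or [g \in far]in_set negbK.
have dP z : (cnorm z <= 2)%N -> has (fun u => ceq z u.1) supp_codes = (cval z \in P).
  move=> z2; rewrite -mem_supp.
  elim: supp_codes small_supp => //= u s IH /andP[u1 /IH ->].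
  by rewrite in_cons ceqE //; lia.
apply/mapP/andP => [[d]|[gP /mapP[z zs ez]]].
  rewrite mem_filter => /andP[dn dd ->]; split.
    by move: dn; rewrite dP //; move: d dd; apply/allP.
  apply/map_f; move: d dd {dn}; exact/allP.
have : z \in [seq u.1 | u <- supp_codes ++ dist_codes] by move: z zs {ez}; apply/allP.
rewrite map_cat mem_cat => /orP[/mapP[u us zu]|/mapP[d ds zd]].
  by move: gP; rewrite ez zu -mem_supp (map_f (fun u => cval u.1)).
exists d; last by rewrite ez zd.
rewrite mem_filter ds andbT dP; first by rewrite -zd -ez.
by move: d ds {zd}; apply/allP.
Qed.

Lemma sum_D (V : nmodType) (f : G -> V) :
  \sum_(g in ~: (P :|: far)) f g = \sum_(d <- LD) f (cval d.1).
Proof.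
rewrite -(big_map (fun d => cval d.1) xpredT f) big_uniq /=.
  by apply: eq_bigl => g; rewrite mem_LD.
by apply: (uniq_cundup (k := 2)); rewrite ?small_dist.
Qed.

Definition rep (i : nat) : code := nth (0, 0) [:: (2, 0); (0, 2); (1, 1); (1, -1)] i.
(** The value of the negative part on a class, set to 0 when the class has no member in [LD].
    Certificates can then always refer to four classes. *)
Definition cv (i : nat) : R := if i \in LE then m (cval (rep i)) else 0.
Definition wv (t : nat) : R := nth 0 [:: 1; l a; l b] t.

Lemma cv_ge0 i : 0 <= cv i.
Proof. by rewrite /cv; case: ifP => // _; apply: negpart_ge0. Qed.

Lemma cvalN z : cval (- z.1, - z.2) = - cval z.
Proof. by rewrite /cval /= !mulrNz opprD. Qed.

Lemma cvE d : d \in LD -> m (cval d.1) = cv d.2.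
Proof.
move=> dD; rewrite /cv (map_f snd dD); move/cundup_sub: dD.
rewrite mem_filter => /andP[_].
have mN g : m (- g) = m g by rewrite /m /negpart leven.
by rewrite !in_cons in_nil orbF; do 7?[case/orP]; move=> /eqP -> //=;
  rewrite -mN -cvalN.
Qed.

Lemma wvE u : u \in LP -> l (cval u.1) = wv u.2.
Proof.
move/cundup_sub; rewrite !in_cons in_nil orbF.
do 4?[case/orP]; move=> /eqP ->;
  by rewrite /wv /cval /= ?mulr0z ?mulrNz ?mulr1z ?addr0 ?add0r ?leven.
Qed.

Lemma disjoint_target F : [disjoint target F & P].
Proof.
apply/pred0P => g /=; apply/negbTE; rewrite negb_and -implybE; apply/implyP.
rewrite in_setU => /orP[|].
  rewrite in_set; apply: contra => gP; rewrite mem_sum_codes.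
  apply/existsP; exists g; rewrite gP; apply/existsP; exists 0.
  by rewrite addr0 eqxx andbT /P lsupp !inE eqxx.
rewrite in_set => /hasP[d dD /andP[_ /eqP ->]].
have := map_f (fun d => cval d.1) dD.
by rewrite mem_LD in_setC in_setU negb_or => /andP[].
Qed.

Lemma big_incidences F s t (f : nat -> nat -> R) (g h : G -> R) :
  small 2 s -> small 2 t ->
  (forall u v, u \in s -> v \in t -> g (cval u.1) * h (cval v.1) = f u.2 v.2) ->
  \sum_(u <- s) \sum_(v <- t) g (cval u.1) * h (cval v.1) * (cval u.1 + cval v.1 \in target F)%:R
  = \sum_(q <- incidences F s t) f q.1 q.2.
Proof.
move=> /allP s2 /allP t2 fE.
rewrite /incidences /incidences_in -/offsum big_map big_filter [RHS]big_mkcond big_allpairs_dep /=.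
rewrite !big_seq; apply: eq_bigr => u us; rewrite !big_seq; apply: eq_bigr => v vt.
rewrite offsumE; last first.
  exact: leq_trans (cnorm_add _ _) (leq_add (s2 _ us) (t2 _ vt)).
by rewrite cval_add; case: ifP => _; rewrite ?mulr1 ?mulr0 // fE.
Qed.

Lemma supp_mass : \sum_(k in P) l k * (1 - l k) = \sum_(t <- LW) wv t * (1 - wv t).
Proof.
rewrite (sum_P (fun g => l g * (1 - l g))) big_map big_seq [RHS]big_seq.
by apply: eq_bigr => u uP; rewrite wvE.
Qed.

Lemma neg_mass_LE : \sum_(i <- LE) cv i <= \sum_(t <- LW) wv t * (1 - wv t).
Proof.
rewrite -supp_mass.
have -> : \sum_(i <- LE) cv i = \sum_(d <- LD) m (cval d.1).
  by rewrite big_map big_seq [RHS]big_seq; apply: eq_bigr => d dD; rewrite cvE.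
apply: le_trans (neg_mass_le lsq).
rewrite -(sum_D m) [leRHS](bigID (mem (~: (P :|: far)))) /=.
by rewrite lerDl sumr_ge0 // => k _; apply: negpart_ge0.
Qed.

(** [conv_ineq] with [E := target F] and [T := far]: dropping [far] removes all unknown masses
    outside P + P, so finitely many variables remain. *)
Lemma table_ineq F : far != set0 -> \sum_k m k <= 1 ->
  0 < \sum_(q <- LC F) wv q.1 * wv q.2 + \sum_(q <- LA F) cv q.1 * cv q.2
      - 2 * \sum_(q <- LN F) cv q.1 * wv q.2.
Proof.
move=> far0 M1.
have sLP : small 2 LP by apply/allP => u /small_LP h; apply: leq_trans h _.
have sLD : small 2 LD by apply/allP => u /small_LD.
have farT : far \subset target F by apply: subsetUl.
have T0 : target F != set0.
  by apply: contraNneq far0 => T0; rewrite -subset0 -T0.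
have := conv_ineq l0 M1 lconv T0 farT (disjoint_target F).
have -> : \sum_(i in P) \sum_(j in P) l i * l j * (i + j \in target F)%:R
    = \sum_(q <- LC F) wv q.1 * wv q.2.
  rewrite sum_P; under eq_bigr do rewrite sum_P.
  by apply: (@big_incidences F _ _ (fun i j => wv i * wv j) l l) => // u v uP vP; rewrite !wvE.
have -> : \sum_(i in ~: (P :|: far)) \sum_(j in ~: (P :|: far))
      m i * m j * (i + j \in target F)%:R = \sum_(q <- LA F) cv q.1 * cv q.2.
  rewrite sum_D; under eq_bigr do rewrite sum_D.
  by apply: (@big_incidences F _ _ (fun i j => cv i * cv j) m m) => // u v uP vP; rewrite !cvE.
have -> // : \sum_(j in ~: (P :|: far)) \sum_(i in P) m j * l i * (j + i \in target F)%:R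
    = \sum_(q <- LN F) cv q.1 * wv q.2.
rewrite sum_D; under eq_bigr do rewrite sum_P.
by apply: (@big_incidences F _ _ (fun i j => cv i * wv j) m l) => // u v uP vP; rewrite cvE ?wvE.
Qed.

End Soundness.
End Table.

(** * Polynomial certificates *)

(** Unfolds a matrix of multiplicities into the list of its index pairs, to be compared as a
    multiset with [incidences]. Missing rows and columns count as 0. *)
Definition entries (A : seq (seq nat)) : seq (nat * nat) :=
  flatten [seq flatten [seq nseq (nth 0%N (nth [::] A i) j) (i, j) | j <- iota 0 4]
          | i <- iota 0 4].
Definition table := (seq nat * seq (seq nat) * seq (seq nat) * seq (seq nat))%type.
Definition cert := (seq nat * seq table)%type.

Definition weight (R : realFieldType) (x y : R) (t : nat) : R := nth 0 [:: 1; x; y] t.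

Definition table_pos (R : realFieldType) (x y : R) (c : nat -> R) (tb : table) : Prop :=
  let: (F, A, N, C) := tb in
  0 < \sum_(q <- entries C) weight x y q.1 * weight x y q.2
      + \sum_(q <- entries A) c q.1 * c q.2
      - 2 * \sum_(q <- entries N) c q.1 * weight x y q.2.

(** Here [x], [y] stand for [l a], [l b], and [p], [q], [r], [t] for the negative parts at 2a, 2b, a
    + b, a - b. The mass bound enters in linear form, with x (1 - x) weakened to x. *)
Definition refuted (C : cert) : Prop :=
  forall (R : realFieldType) (x y p q r t : R),
  0 <= x -> x <= 1 -> 0 <= y -> y <= 1 -> 0 <= p -> 0 <= q -> 0 <= r -> 0 <= t ->
  \sum_(i <- C.1) nth 0 [:: p; q; r; t] i <= 2 * (x + y) ->
  (forall i, (i < size C.2)%N ->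
     table_pos x y (nth 0 [:: p; q; r; t]) (nth ([::], [::], [::], [::]) C.2 i)) ->
  False.

Local Open Scope nat_scope.
(* In a certificate the first list gives the tags of the elements of (P + P) - P
   with multiplicity. In a table (F, A, N, C), F selects the tags of the elements
   added to the complement of P + P, and A, N, C count the incidences between two
   negative, a negative and a positive, and two positive values. *)
Definition certD : cert := ([:: 1; 1; 2; 2], [::
  ([::], [:: [:: 0; 0; 0; 0]; [:: 0; 2; 2; 0]; [:: 0; 2; 0; 0]; [:: 0; 0; 0; 0]],
   [:: [:: 0; 0; 0]; [:: 0; 2; 2]; [:: 0; 0; 2]; [:: 0; 0; 0]],
   [:: [:: 0; 0; 0]; [:: 0; 0; 0]; [:: 0; 0; 0]])]).
Definition certE : cert := ([:: 0; 0; 1; 1; 2; 2], [::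
  ([::], [:: [:: 0; 2; 0; 0]; [:: 2; 2; 2; 0]; [:: 0; 2; 2; 0]; [:: 0; 0; 0; 0]],
   [:: [:: 0; 0; 2]; [:: 0; 4; 2]; [:: 0; 2; 2]; [:: 0; 0; 0]],
   [:: [:: 0; 0; 0]; [:: 0; 0; 0]; [:: 0; 0; 0]])]).
Definition certA : cert := ([:: 1; 1; 2; 2], [::
  ([::], [:: [:: 0; 0; 0; 0]; [:: 0; 2; 2; 0]; [:: 0; 2; 2; 0]; [:: 0; 0; 0; 0]],
   [:: [:: 0; 0; 0]; [:: 0; 2; 2]; [:: 0; 0; 2]; [:: 0; 0; 0]],
   [:: [:: 0; 0; 0]; [:: 0; 0; 0]; [:: 0; 0; 0]]);
  ([:: 2], [:: [:: 0; 0; 0; 0]; [:: 0; 2; 2; 0]; [:: 0; 2; 2; 0]; [:: 0; 0; 0; 0]],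
   [:: [:: 0; 0; 0]; [:: 0; 4; 2]; [:: 2; 0; 2]; [:: 0; 0; 0]],
   [:: [:: 0; 0; 0]; [:: 0; 0; 2]; [:: 0; 2; 0]])]).
Definition certC : cert := ([:: 0; 0; 1; 1; 2; 2; 3; 3], [::
  ([::], [:: [:: 2; 2; 2; 0]; [:: 2; 2; 2; 2]; [:: 2; 2; 2; 0]; [:: 0; 2; 0; 0]],
   [:: [:: 0; 0; 2]; [:: 0; 2; 2]; [:: 0; 2; 2]; [:: 0; 0; 0]],
   [:: [:: 0; 0; 0]; [:: 0; 0; 0]; [:: 0; 0; 0]]);
  ([:: 1], [:: [:: 2; 2; 2; 0]; [:: 2; 2; 2; 2]; [:: 2; 2; 2; 2]; [:: 0; 2; 2; 0]],
   [:: [:: 0; 2; 2]; [:: 2; 2; 2]; [:: 0; 2; 2]; [:: 0; 0; 0]],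
   [:: [:: 0; 0; 0]; [:: 0; 0; 0]; [:: 0; 0; 2]])]).
Definition certT3 : cert := ([:: 1; 1; 2; 2; 3; 3], [::
  ([::], [:: [:: 0; 0; 0; 0]; [:: 0; 2; 2; 2]; [:: 0; 2; 2; 0]; [:: 0; 2; 0; 2]],
   [:: [:: 0; 0; 0]; [:: 0; 4; 2]; [:: 0; 0; 2]; [:: 0; 0; 2]],
   [:: [:: 0; 0; 0]; [:: 0; 0; 0]; [:: 0; 0; 0]]);
  ([:: 2], [:: [:: 0; 0; 0; 0]; [:: 0; 2; 2; 4]; [:: 0; 2; 2; 0]; [:: 0; 4; 0; 2]],
   [:: [:: 0; 0; 0]; [:: 0; 4; 2]; [:: 2; 0; 2]; [:: 0; 2; 2]],
   [:: [:: 0; 0; 0]; [:: 0; 0; 2]; [:: 0; 2; 0]])]).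
Definition certB : cert := ([:: 0; 0; 1; 1; 2; 2; 3; 3], [::
  ([::], [:: [:: 0; 4; 2; 0]; [:: 4; 2; 2; 2]; [:: 2; 2; 2; 0]; [:: 0; 2; 0; 2]],
   [:: [:: 0; 0; 2]; [:: 0; 4; 2]; [:: 0; 2; 2]; [:: 0; 0; 2]],
   [:: [:: 0; 0; 0]; [:: 0; 0; 0]; [:: 0; 0; 0]]);
  ([:: 3], [:: [:: 0; 4; 4; 0]; [:: 4; 2; 4; 2]; [:: 4; 4; 2; 0]; [:: 0; 2; 0; 2]],
   [:: [:: 0; 2; 2]; [:: 0; 4; 2]; [:: 0; 2; 2]; [:: 2; 0; 2]],
   [:: [:: 0; 0; 0]; [:: 0; 0; 2]; [:: 0; 2; 0]])]).
Definition certB16 : cert := ([:: 0; 0; 1; 2; 2; 3; 3], [::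
  ([::], [:: [:: 0; 2; 2; 0]; [:: 2; 0; 0; 0]; [:: 2; 0; 2; 0]; [:: 0; 0; 0; 2]],
   [:: [:: 0; 0; 2]; [:: 0; 2; 0]; [:: 0; 2; 2]; [:: 0; 0; 2]],
   [:: [:: 0; 0; 0]; [:: 0; 0; 0]; [:: 0; 0; 0]]);
  ([:: 3], [:: [:: 0; 2; 4; 0]; [:: 2; 0; 2; 0]; [:: 4; 2; 2; 0]; [:: 0; 0; 0; 2]],
   [:: [:: 0; 2; 2]; [:: 0; 2; 0]; [:: 0; 2; 2]; [:: 2; 0; 2]],
   [:: [:: 0; 0; 0]; [:: 0; 0; 2]; [:: 0; 2; 0]]);
  ([:: 0], [:: [:: 0; 2; 2; 0]; [:: 2; 0; 0; 0]; [:: 2; 0; 2; 2]; [:: 0; 0; 2; 2]],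
   [:: [:: 2; 0; 4]; [:: 0; 2; 0]; [:: 0; 2; 2]; [:: 0; 2; 2]],
   [:: [:: 0; 0; 0]; [:: 0; 2; 0]; [:: 0; 0; 0]])]).
Definition certB17 : cert := ([:: 0; 0; 1; 1; 2; 2; 3; 3], [::
  ([::], [:: [:: 0; 4; 2; 0]; [:: 4; 0; 0; 2]; [:: 2; 0; 2; 0]; [:: 0; 2; 0; 2]],
   [:: [:: 0; 0; 2]; [:: 0; 2; 0]; [:: 0; 2; 0]; [:: 0; 0; 2]],
   [:: [:: 0; 0; 0]; [:: 0; 0; 0]; [:: 0; 0; 0]]);
  ([:: 1; 3], [:: [:: 0; 4; 4; 0]; [:: 4; 0; 2; 2]; [:: 4; 2; 2; 2]; [:: 0; 2; 2; 2]],
   [:: [:: 0; 2; 2]; [:: 2; 4; 0]; [:: 0; 2; 2]; [:: 2; 0; 2]],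
   [:: [:: 0; 0; 0]; [:: 0; 0; 2]; [:: 0; 2; 2]]);
  ([:: 0; 2], [:: [:: 0; 4; 2; 2]; [:: 4; 0; 0; 4]; [:: 2; 0; 2; 2]; [:: 2; 4; 2; 2]],
   [:: [:: 2; 0; 4]; [:: 0; 2; 2]; [:: 2; 2; 0]; [:: 0; 2; 2]],
   [:: [:: 0; 0; 0]; [:: 0; 2; 2]; [:: 0; 2; 0]])]).
Definition certB20 : cert := ([:: 0; 0; 1; 1; 2; 2; 3; 3], [::
  ([::], [:: [:: 0; 4; 2; 0]; [:: 4; 0; 2; 2]; [:: 2; 2; 2; 0]; [:: 0; 2; 0; 2]],
   [:: [:: 0; 0; 2]; [:: 0; 4; 0]; [:: 0; 2; 2]; [:: 0; 0; 2]],
   [:: [:: 0; 0; 0]; [:: 0; 0; 0]; [:: 0; 0; 0]]);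
  ([:: 3], [:: [:: 0; 4; 4; 0]; [:: 4; 0; 4; 2]; [:: 4; 4; 2; 0]; [:: 0; 2; 0; 2]],
   [:: [:: 0; 2; 2]; [:: 0; 4; 0]; [:: 0; 2; 2]; [:: 2; 0; 2]],
   [:: [:: 0; 0; 0]; [:: 0; 0; 2]; [:: 0; 2; 0]]);
  ([:: 1], [:: [:: 0; 4; 2; 0]; [:: 4; 0; 2; 2]; [:: 2; 2; 2; 2]; [:: 0; 2; 2; 2]],
   [:: [:: 0; 0; 2]; [:: 2; 4; 2]; [:: 0; 2; 2]; [:: 0; 0; 2]],
   [:: [:: 0; 0; 0]; [:: 0; 0; 0]; [:: 0; 0; 2]])]).
Definition certT4 : cert := ([:: 0; 1; 1; 2; 2; 3; 3], [::
  ([::], [:: [:: 0; 2; 0; 0]; [:: 2; 2; 2; 2]; [:: 0; 2; 2; 0]; [:: 0; 2; 0; 2]],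
   [:: [:: 0; 0; 2]; [:: 0; 4; 2]; [:: 0; 2; 2]; [:: 0; 2; 2]],
   [:: [:: 0; 0; 0]; [:: 0; 0; 0]; [:: 0; 0; 0]])]).
Definition certT5 : cert := ([:: 0; 0; 1; 1; 2; 2; 3; 3], [::
  ([::], [:: [:: 0; 4; 2; 2]; [:: 4; 2; 2; 2]; [:: 2; 2; 2; 0]; [:: 2; 2; 0; 2]],
   [:: [:: 0; 0; 4]; [:: 0; 4; 2]; [:: 0; 2; 2]; [:: 0; 2; 2]],
   [:: [:: 0; 0; 0]; [:: 0; 0; 0]; [:: 0; 0; 0]])]).
Definition certT20 : cert := ([:: 0; 1; 1; 2; 2; 3; 3], [::
  ([::], [:: [:: 0; 2; 0; 0]; [:: 2; 0; 2; 2]; [:: 0; 2; 2; 0]; [:: 0; 2; 0; 2]],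
   [:: [:: 0; 0; 2]; [:: 0; 4; 0]; [:: 0; 2; 2]; [:: 0; 2; 2]],
   [:: [:: 0; 0; 0]; [:: 0; 0; 0]; [:: 0; 0; 0]])]).
Local Open Scope ring_scope.

Ltac table_simpl := rewrite /table_pos /entries /weight /= !big_cons !big_nil /=.

(** The mass bound reads q + r <= x + y, hence 2q^2 + 4qr <= 4q(x + y), and the cross terms are at
    least this large. *)
Lemma certD_refuted : refuted certD.
Proof.
move=> R x y p q r t x0 x1 y0 y1 p0 q0 r0 t0; rewrite !big_cons big_nil /= => K hT.
have := hT 0%N isT; table_simpl => G; nra.
Qed.

Lemma certE_refuted : refuted certE.
Proof.
move=> R x y p q r t x0 x1 y0 y1 p0 q0 r0 t0; rewrite !big_cons big_nil /= => K hT.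
have := hT 0%N isT; table_simpl => G; nra.
Qed.

Lemma certT4_refuted : refuted certT4.
Proof.
move=> R x y p q r t x0 x1 y0 y1 p0 q0 r0 t0; rewrite !big_cons big_nil /= => K hT.
(* Both branches use the same table; the split only supplies the sign of q - y for the products
   formed by [nra]. *)
have [h1|/ltW h1] := leP (y) q.
  have := hT 0%N isT; table_simpl => G; nra.
have := hT 0%N isT; table_simpl => G; nra.
Qed.

Lemma certT5_refuted : refuted certT5.
Proof.
move=> R x y p q r t x0 x1 y0 y1 p0 q0 r0 t0; rewrite !big_cons big_nil /= => K hT.
have [h1|/ltW h1] := leP (y) q.
  have := hT 0%N isT; table_simpl => G; nra.
have := hT 0%N isT; table_simpl => G; nra.
Qed.

Lemma certT20_refuted : refuted certT20.
Proof.
move=> R x y p q r t x0 x1 y0 y1 p0 q0 r0 t0; rewrite !big_cons big_nil /= => K hT.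
have [h1|/ltW h1] := leP (y) q.
  have := hT 0%N isT; table_simpl => G; nra.
have := hT 0%N isT; table_simpl => G; nra.
Qed.

(** Adding the class of a + b to the test set changes the bound by 4xy - 4qx - 4r. This is a gain
    when r is large, so the second table is used for r >= 2y and the first one otherwise. *)
Lemma certA_refuted : refuted certA.
Proof.
move=> R x y p q r t x0 x1 y0 y1 p0 q0 r0 t0; rewrite !big_cons big_nil /= => K hT.
have [h1|/ltW h1] := leP (2 * y) r.
  have := hT 1%N isT; table_simpl => G; nra.
have := hT 0%N isT; table_simpl => G; nra.
Qed.

Lemma certC_refuted : refuted certC.
Proof.
move=> R x y p q r t x0 x1 y0 y1 p0 q0 r0 t0; rewrite !big_cons big_nil /= => K hT.
have [h1|/ltW h1] := leP (y) p.
  have := hT 1%N isT; table_simpl => G; nra.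
have := hT 0%N isT; table_simpl => G; nra.
Qed.

Lemma certT3_refuted : refuted certT3.
Proof.
move=> R x y p q r t x0 x1 y0 y1 p0 q0 r0 t0; rewrite !big_cons big_nil /= => K hT.
have [h1|/ltW h1] := leP (y) r.
  have := hT 1%N isT; table_simpl => G; nra.
have [h2|/ltW h2] := leP (2 * y) t.
  have := hT 1%N isT; table_simpl => G; nra.
have := hT 0%N isT; table_simpl => G; nra.
Qed.

Lemma certB_refuted : refuted certB.
Proof.
move=> R x y p q r t x0 x1 y0 y1 p0 q0 r0 t0; rewrite !big_cons big_nil /= => K hT.
have [h1|/ltW h1] := leP (2 * y) t.
  have := hT 1%N isT; table_simpl => G; nra.
have [h2|/ltW h2] := leP (y) q.
  have := hT 0%N isT; table_simpl => G; nra.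
have := hT 0%N isT; table_simpl => G; nra.
Qed.

Lemma certB16_refuted : refuted certB16.
Proof.
move=> R x y p q r t x0 x1 y0 y1 p0 q0 r0 t0; rewrite !big_cons big_nil /= => K hT.
have [h1|/ltW h1] := leP (2 * y) t.
  have := hT 1%N isT; table_simpl => G; nra.
have [h2|/ltW h2] := leP (2 * y) q.
  have := hT 0%N isT; table_simpl => G; nra.
have [h3|/ltW h3] := leP (y) q.
  have [h4|/ltW h4] := leP (x) p.
    have := hT 2%N isT; table_simpl => G; nra.
  have := hT 0%N isT; table_simpl => G; nra.
have := hT 0%N isT; table_simpl => G; nra.
Qed.

Lemma certB20_refuted : refuted certB20.
Proof.
move=> R x y p q r t x0 x1 y0 y1 p0 q0 r0 t0; rewrite !big_cons big_nil /= => K hT.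
have [h1|/ltW h1] := leP (2 * y) t.
  have := hT 1%N isT; table_simpl => G; nra.
have [h2|/ltW h2] := leP (y) q.
  have := hT 0%N isT; table_simpl => G; nra.
have [h3|/ltW h3] := leP (y) t.
  have := hT 1%N isT; table_simpl => G; nra.
have [h4|/ltW h4] := leP (y) p.
  have := hT 0%N isT; table_simpl => G; nra.
have [h5|/ltW h5] := leP (y / 2) q.
  have := hT 2%N isT; table_simpl => G; nra.
have := hT 0%N isT; table_simpl => G; nra.
Qed.

(** The hypotheses are the first two tables of [certB17], divided by 2, in the range y <= x. *)
Lemma certB17_half (R : realFieldType) (x y p q r t : R) :
  0 <= x -> x <= 1 -> 0 <= y -> y <= 1 -> 0 <= p -> 0 <= q -> 0 <= r -> 0 <= t ->
  y <= x -> p + q + r + t <= x + y ->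
  0 < 4 * p * q + 2 * p * r + 2 * q * t + r ^+ 2 + t ^+ 2
      - 2 * (p * y + q * x + r * x + t * y) ->
  0 < 2 * x * y + y ^+ 2 + 4 * p * q + 4 * p * r + 2 * q * r + 2 * q * t
      + r ^+ 2 + 2 * r * t + t ^+ 2
      - 2 * (p * (x + y) + q * (1 + 2 * x) + r * (x + y) + t * (1 + y)) ->
  False.
Proof.
move=> x0 x1 y0 y1 p0 q0 r0 t0 yx K G F.
have [h1|/ltW h1] := leP y q; first by clear G; nra.
have [h2|/ltW h2] := leP y t; first by clear G; nra.
have [h3|/ltW h3] := leP ((x + y) / 2) p; first by clear G; nra.
clear F; have [h4|/ltW h4] := leP ((x + y) / 2) r; first by nra.
by have [h5|/ltW h5] := leP (x / 2) p; nra.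
Qed.

Lemma certB17_refuted : refuted certB17.
Proof.
move=> R x y p q r t x0 x1 y0 y1 p0 q0 r0 t0; rewrite !big_cons big_nil /= => K hT.
have := hT 0%N isT; table_simpl => G.
have [yx|/ltW xy] := leP y x.
  have := hT 1%N isT; table_simpl => F.
  by apply: (@certB17_half _ x y p q r t) => //; lra.
have := hT 2%N isT; table_simpl => F.
(* The relations b = 4a and 17a = 0 are preserved by a -> b, b -> -a. This exchanges x with y, p
   with q and r with t, and the third table with the second. *)
by apply: (@certB17_half _ y x q p t r) => //; lra.
Qed.

(** * Soundness of the certificates *)

Definition sub_mset (T : eqType) (s t : seq T) := all (fun z => count_mem z s <= count_mem z t)%N s.

Lemma sub_mset_sum (R : numDomainType) (T : eqType) (f : T -> R) (s t : seq T) :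
  (forall z, 0 <= f z) -> sub_mset s t -> \sum_(z <- s) f z <= \sum_(z <- t) f z.
Proof.
move=> f0 /allP st.
have /count_subseqP[s' ss' pss'] : forall z, (count_mem z s <= count_mem z t)%N.
  by move=> z; case: (boolP (z \in s)) => [/st//|/count_memPn ->].
rewrite (perm_big _ pss') /=; elim: t s' ss' {st pss'} => [|z t IH] s' /=.
  by move/eqP => ->; rewrite !big_nil.
case: s' => [|w s'] h; first by rewrite big_nil sumr_ge0.
move: h; rewrite [leRHS]big_cons; case: eqP => [->|_] h.
  by rewrite big_cons lerD2l IH.
by apply: le_trans (IH _ h) _; rewrite lerDr.
Qed.

(** Only inequalities of counts are required: a table may overestimate A and C and underestimate N.
    One certificate thus serves several relation patterns. Rows of N for absent classes are ignored,
    their values being 0. *)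
Definition table_ok rel D U (tb : table) : bool :=
  let: (F, A, N, C) := tb in
  [&& sub_mset (incidences_in rel D F D D) (entries A),
      sub_mset [seq q <- entries N | q.1 \in [seq d.2 | d <- D]] (incidences_in rel D F D U) &
      sub_mset (incidences_in rel D F U U) (entries C)].
Definition cert_ok rel (C : cert) : bool :=
  let D := LD rel in
  let E := [seq d.2 | d <- D] in
  sub_mset [seq i <- C.1 | i \in E] E && all (table_ok rel D (LP rel)) C.2.

(* Without a short relation every negative class meets the test set through both
   a and b, so the cross terms dominate the quadratic ones by the mass bound. *)
Definition generic_ok rel : bool :=
  let D := LD rel in
  let U := LP rel in
  let W := [seq u.2 | u <- U] in
  nilp (incidences_in rel D [::] U U) &&
  all (fun d => ~~ has (fun d' => offsum_in rel D [::] (cadd d.1 d'.1)) D ||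
     all (fun t => (t == 0%N) || (count_mem t W <=
       2 * count_mem t [seq u.2 | u <- U & offsum_in rel D [::] (cadd d.1 u.1)])%N) W) D.

Lemma big_incidence_list (V : nmodType) rel F s t (f : nat -> nat -> V) :
  \sum_(q <- incidences rel F s t) f q.1 q.2 =
  \sum_(u <- s) \sum_(v <- t) (if offsum rel F (cadd u.1 v.1) then f u.2 v.2 else 0).
Proof.
by rewrite /incidences /incidences_in big_map big_filter big_mkcond big_allpairs_dep.
Qed.

Section Soundness.
Variables (rel : code -> bool).
Variables (R : realFieldType) (G : finZmodType) (l : G -> R) (a b : G).
Hypothesis relP : forall z, (cnorm z <= 6)%N -> rel z = (cval a b z == 0).
Hypotheses (leven : forall k, l (- k) = l k) (l0 : l 0 = 1).
Hypothesis lmax : forall k, l k <= 1.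
Hypothesis lsq : \sum_k l k ^+ 2 <= \sum_k l k.
Hypothesis lconv : forall k, 0 < conv l k.
Hypothesis lsupp : possupp l = [set 0; a; - a; b; - b].
Hypothesis far0 : far a b != set0.

Let c := cv rel l a b.
Let w := wv l a b.

Lemma la0 : 0 < l a.
Proof.
suff: a \in possupp l by rewrite inE.
by rewrite lsupp !inE eqxx ?orbT.
Qed.

Lemma lb0 : 0 < l b.
Proof.
suff: b \in possupp l by rewrite inE.
by rewrite lsupp !inE eqxx ?orbT.
Qed.

Lemma w0 t : 0 <= w t.
Proof.
by case: t => [|[|[|t]]]; rewrite /w /wv /= ?nth_nil // ltW // ?la0 ?lb0.
Qed.

Lemma w1 t : w t <= 1.
Proof. by case: t => [|[|[|t]]]; rewrite /w /wv /= ?nth_nil. Qed.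

Lemma c0 i : 0 <= c i. Proof. exact: cv_ge0. Qed.

Lemma cundup_subseq s : subseq (cundup rel s) s.
Proof.
elim: s => //= z s IH; case: ifP => _; last by rewrite eqxx.
exact: subseq_trans IH (subseq_cons _ _).
Qed.

(** Coincidences among the codes only remove nonnegative terms, so the bound for five distinct
    elements also covers degenerate pairs a, b. *)
Lemma LW_mass :
  \sum_(t <- LW rel) w t * (1 - w t) <= 2 * (l a * (1 - l a) + l b * (1 - l b)).
Proof.
have -> : 2 * (l a * (1 - l a) + l b * (1 - l b)) =
    \sum_(u <- supp_codes) w u.2 * (1 - w u.2).
  by rewrite !big_cons big_nil /w /wv /=; ring.
rewrite big_map; have := cundup_subseq supp_codes; rewrite -/(LP rel).
have w01 t : 0 <= w t * (1 - w t) by rewrite mulr_ge0 ?subr_ge0 ?w0 ?w1.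
elim: supp_codes (LP rel) => [|v t IH] s; first by rewrite subseq0 => /eqP ->.
case: s => [|u s] /=; first by rewrite big_nil sumr_ge0.
rewrite [leRHS]big_cons; case: eqP => [->|_] h; first by rewrite big_cons lerD2l IH.
by apply: le_trans (IH _ h) _; rewrite lerDr.
Qed.

Lemma LE_mass : \sum_(i <- LE rel) c i <= 2 * (l a * (1 - l a) + l b * (1 - l b)).
Proof. exact: le_trans (neg_mass_LE relP leven l0 lsq lsupp) LW_mass. Qed.

(** Each of the four terms z (1 - z) is at most 1/4. *)
Lemma mass1 : \sum_k negpart l k <= 1.
Proof.
apply: le_trans (neg_mass_le lsq) _; rewrite (supp_mass relP) //.
apply: le_trans LW_mass _.
by have := (sqr_ge0 (l a - 2^-1), sqr_ge0 (l b - 2^-1)); case=> ha hb; nra.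
Qed.

Lemma cert_sound C : refuted C -> cert_ok rel C -> False.
Proof.
move=> /(_ R (l a) (l b) (c 0%N) (c 1%N) (c 2%N) (c 3%N)) ref /andP[okE /allP okT].
have cE i : nth 0 [:: c 0%N; c 1%N; c 2%N; c 3%N] i = c i.
  case: i => [|[|[|[|i]]]] //=; rewrite nth_nil /c /cv; case: ifP => // /mapP[d].
  by move/cundup_sub; rewrite mem_filter => /andP[_]; rewrite !inE;
    do 7?[case/orP]; move=> /eqP ->.
have [la lb] := (ltW la0, ltW lb0); apply: ref; rewrite ?lmax ?c0 //.
  under eq_bigr do rewrite cE.
  have e : \sum_(i <- C.1) c i = \sum_(i <- [seq i <- C.1 | i \in LE rel]) c i.
    rewrite big_filter [RHS]big_mkcond /=; apply: eq_bigr => i _.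
    by rewrite /c /cv; case: ifP.
  rewrite e; apply: le_trans (sub_mset_sum c0 okE) _; apply: le_trans LE_mass _.
  have [ha hb] := (la0, lb0); nra.
move=> i /(mem_nth ([::], [::], [::], [::])) /okT.
case: nth => [[[F A] N] D] /and3P[okA okN okC] /=.
have := table_ineq relP leven l0 lsq lconv lsupp F far0 mass1.
rewrite -/c -/w.
have cc0 (q : nat * nat) : 0 <= c q.1 * c q.2 by rewrite mulr_ge0 ?c0.
have cw0 (q : nat * nat) : 0 <= c q.1 * w q.2 by rewrite mulr_ge0 ?c0 ?w0.
have ww0 (q : nat * nat) : 0 <= w q.1 * w q.2 by rewrite mulr_ge0 ?w0.
have := sub_mset_sum ww0 okC; have := sub_mset_sum cc0 okA.
have := sub_mset_sum cw0 okN.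
have -> : \sum_(q <- [seq q <- entries N | q.1 \in LE rel]) c q.1 * w q.2 =
    \sum_(q <- entries N) c q.1 * w q.2.
  rewrite big_filter big_mkcond /=; apply: eq_bigr => q _.
  by rewrite /c /cv; case: (q.1 \in LE rel); rewrite ?mul0r.
have -> : \sum_(q <- entries A) [:: c 0%N; c 1%N; c 2%N; c 3%N]`_q.1 *
    [:: c 0%N; c 1%N; c 2%N; c 3%N]`_q.2 = \sum_(q <- entries A) c q.1 * c q.2.
  by apply: eq_bigr => q _; rewrite !cE.
have -> : \sum_(q <- entries N) [:: c 0%N; c 1%N; c 2%N; c 3%N]`_q.1 *
    weight (l a) (l b) q.2 = \sum_(q <- entries N) c q.1 * w q.2.
  by apply: eq_bigr => q _; rewrite cE.
rewrite -[weight _ _]/w; lra.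
Qed.

Lemma generic_sound : generic_ok rel -> False.
Proof.
rewrite /generic_ok; cbv zeta.
rewrite -[incidences_in _ _ _ _ _]/(LC rel [::]) -/(offsum rel) -/(LW rel).
move=> /andP[/nilP LC0 /allP ok].
have := table_ineq relP leven l0 lsq lconv lsupp [::] far0 mass1.
rewrite LC0 big_nil add0r -/c -/w; apply/negP; rewrite -leNgt subr_le0.
rewrite /LA (big_incidence_list _ _ _ _ (fun i j => c i * c j)) /LN.
rewrite (big_incidence_list _ _ _ _ (fun i j => c i * w j)) mulr_sumr big_seq [leRHS]big_seq.
apply: ler_sum => d dD; have := ok _ dD; case/orP => [/hasPn h|/allP h].
  rewrite [leLHS]big_seq big1 => [|d' d'D]; last by rewrite (negPf (h _ d'D)).
  by rewrite mulr_ge0 // sumr_ge0 // => u _; case: ifP => // _; rewrite mulr_ge0 ?c0 ?w0.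
apply: (@le_trans _ _ (c d.2 * \sum_(t <- LW rel) w t * (1 - w t))).
  apply: (@le_trans _ _ (c d.2 * \sum_(i <- LE rel) c i)); last first.
    by rewrite ler_wpM2l ?c0 // (neg_mass_LE relP leven l0 lsq lsupp).
  rewrite big_map mulr_sumr; apply: ler_sum => d' _; case: ifP => // _.
  by rewrite mulr_ge0 ?c0.
(* Tag 0 carries weight 1 and contributes nothing to the mass bound. Every other tag occurs at most
   twice as often in the support as among the neighbours [nb], and the factor 2 of the cross terms
   absorbs this. *)
pose s := [seq t <- LW rel | t != 0%N].
pose nb := [seq u.2 | u <- LP rel & offsum rel [::] (cadd d.1 u.1)].
have h2 : \sum_(t <- s) w t <= \sum_(t <- nb ++ nb) w t.
  apply: sub_mset_sum w0 _; apply/allP => t; rewrite mem_filter => /andP[t0 tW].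
  rewrite count_filter count_cat addnn -mul2n; have := h _ tW; rewrite (negPf t0) /=.
  apply: leq_trans; apply: sub_count => z /=; by case/andP.
have h1 : \sum_(t <- LW rel) w t * (1 - w t) <= \sum_(t <- s) w t.
  rewrite big_filter [leRHS]big_mkcond /=; apply: ler_sum => t _; case: eqP => [->|_] /=.
    by rewrite /w /wv /= subrr mulr0.
  by rewrite ler_piMr ?w0 // gerBl w0.
have -> : \sum_(v <- LP rel) (if offsum rel [::] (cadd d.1 v.1) then c d.2 * w v.2 else 0)
    = c d.2 * \sum_(t <- nb) w t.
  rewrite mulr_sumr /nb big_map big_filter [RHS]big_mkcond /=; apply: eq_bigr => u _.
  by case: ifP => //; rewrite mulr0.
rewrite mulrCA ler_wpM2l ?c0 //; apply: le_trans h1 (le_trans h2 _).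
by rewrite big_cat /= mulr_natl mulr2n.
Qed.

End Soundness.

(* The relations s a + t b = 0 and s a - t b = 0 with s + t <= 6. *)
Definition pattern := (seq (seq bool) * seq (seq bool))%type.
Definition tri (f : nat -> nat -> bool) : seq (seq bool) :=
  mkseq (fun s => mkseq (f s) (7 - s)) 7.
Definition rel_of (L : pattern) (z : code) : bool :=
  let T := match z with
           | (Posz _, Posz _) | (Negz _, Negz _) => L.1
           | _ => L.2
           end in
  nth false (nth [::] T `|z.1|%N) `|z.2|%N.

Lemma nth_tri f s t : (s + t <= 6)%N -> nth false (nth [::] (tri f) s) t = f s t.
Proof. by move=> st; rewrite /tri !nth_mkseq //; lia. Qed.

Lemma eq_tri f g : (forall s t, (s + t <= 6)%N -> f s t = g s t) -> tri f = tri g.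
Proof.
move=> fg; apply: (@eq_from_nth _ [::]); rewrite !size_mkseq // => s s7.
rewrite !nth_mkseq //; apply: (@eq_from_nth _ false); rewrite !size_mkseq // => t t7.
by rewrite !nth_mkseq // fg //; lia.
Qed.

Definition pat_of (G : zmodType) (a b : G) : pattern :=
  (tri (fun s t => a *+ s + b *+ t == 0), tri (fun s t => a *+ s == b *+ t)).

Lemma rel_pat_of (G : finZmodType) (a b : G) z : (cnorm z <= 6)%N ->
  rel_of (pat_of a b) z = (cval a b z == 0).
Proof.
case: z => [[s|s] [t|t]] st;
  apply: (etrans (nth_tri _ st)); rewrite /cval //=.
- by rewrite NegzE mulrNz subr_eq0.
- by rewrite NegzE mulrNz addrC subr_eq0 eq_sym.
- by rewrite !NegzE !mulrNz -opprD oppr_eq0.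
Qed.

(** The substitutions (a, b), (b, a), (a, -b), (b, -a). Up to a common sign these are all signed
    permutations of the pair, and they fix the set P. *)
Definition variants : seq (code * code) :=
  [:: ((1, 0), (0, 1)); ((0, 1), (1, 0)); ((1, 0), (0, -1)); ((0, 1), (-1, 0))].
Definition twist (v : code * code) (rel : code -> bool) (z : code) : bool :=
  rel (z.1 * v.1.1 + z.2 * v.2.1, z.1 * v.1.2 + z.2 * v.2.2).
(* Each certificate is guarded by a relation that holds in the patterns it is
   meant for, so that most candidates are rejected without computing tables. *)
Definition certs : seq (code * cert) :=
  [:: ((2, 0), certD); ((3, -1), certE); ((2, -1), certA); ((3, -2), certC);
      ((3, 0), certT3); ((4, -1), certB); ((4, 0), certT4); ((5, 0), certT5);
      ((4, -1), certB16); ((4, -1), certB17); ((4, -1), certB20); ((4, 0), certT20)].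
(* [find] and [if] replace [has] and [&&], whose arguments [vm_compute] would
   evaluate eagerly. *)
Definition pat_ok (L : pattern) : bool :=
  if generic_ok (rel_of L) then true else
  let cert_fits v C :=
    if twist v (rel_of L) C.1 then cert_ok (twist v (rel_of L)) C.2 else false in
  (find (fun v => find (cert_fits v) certs < size certs) variants < size variants)%N.

Lemma pat_okP L : pat_ok L -> generic_ok (rel_of L) \/
  exists2 v, v \in variants & exists2 i, (i < size certs)%N &
    cert_ok (twist v (rel_of L)) (nth ((0, 0), ([::], [::])) certs i).2.
Proof.
rewrite /pat_ok; case: ifP => [|_]; first by left.
rewrite -has_find => /hasP[v vv]; rewrite -has_find => /(has_nthP ((0, 0), ([::], [::]))).
by case=> i iC; case: ifP => // _ ok; right; exists v => //; exists i.
Qed.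

Lemma certs_refuted i : (i < size certs)%N -> refuted (nth ((0, 0), ([::], [::])) certs i).2.
Proof.
case: i => [|[|[|[|[|[|[|[|[|[|[|[|i]]]]]]]]]]]] // _ /=.
exact: certD_refuted. exact: certE_refuted. exact: certA_refuted.
exact: certC_refuted. exact: certT3_refuted. exact: certB_refuted.
exact: certT4_refuted. exact: certT5_refuted. exact: certB16_refuted.
exact: certB17_refuted. exact: certB20_refuted. exact: certT20_refuted.
Qed.

Section PatternSoundness.
Variables (R : realFieldType) (G : finZmodType) (l : G -> R).
Hypotheses (leven : forall k, l (- k) = l k) (l0 : l 0 = 1).
Hypothesis lmax : forall k, l k <= 1.
Hypothesis lsq : \sum_k l k ^+ 2 <= \sum_k l k.
Hypothesis lconv : forall k, 0 < conv l k.
Hypothesis G14 : (13 < #|G|)%N.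

(** P + P has at most 13 elements, the length of [sum_codes]. *)
Lemma far_neq0 (a b : G) : far a b != set0.
Proof.
apply/negP => /eqP f0; have := G14; rewrite ltnNge => /negP; apply.
have all_in g : g \in [seq cval a b z | z <- sum_codes].
  apply: contraT => h; have : g \in far a b by rewrite in_set.
  by rewrite f0 in_set0.
apply: (leq_trans _ (card_size [seq cval a b z | z <- sum_codes])).
by apply/subset_leq_card/subsetP => g _; apply: all_in.
Qed.

Lemma pat_sound (a b : G) :
  possupp l = [set 0; a; - a; b; - b] -> pat_ok (pat_of a b) -> False.
Proof.
move=> lsupp /pat_okP[|[v vv [i iC]]].
  by apply: (generic_sound (rel_pat_of a b)) => //; apply: far_neq0.
apply: (@cert_sound _ R G l (cval a b v.1) (cval a b v.2)) => //.
- move=> z z6; rewrite /twist rel_pat_of; last first.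
    by move: vv z6; rewrite !inE => /or4P[] /eqP -> /=; rewrite /cnorm /=; lia.
  congr (_ == _); rewrite /cval /= !mulrzDr !mulrzDl -!mulrzA.
  by rewrite ![_ * v.1.1]mulrC ![_ * v.1.2]mulrC ![_ * v.2.1]mulrC ![_ * v.2.2]mulrC addrACA.
- rewrite lsupp; apply/setP => g; move: vv; rewrite !inE => /or4P[] /eqP ->;
   rewrite /cval /= !mulr0z ?mulrNz !mulr1z ?add0r ?addr0 ?opprK;
   by do ![case: eqP => _ //=].
- exact: far_neq0.
- exact: certs_refuted.
Qed.

End PatternSoundness.

(** * Enumeration of relation patterns *)

Definition pat_mod (n a b : nat) : pattern :=
  (tri (fun s t => (s * a + t * b) %% n == 0)%N,
   tri (fun s t => (s * a) %% n == (t * b) %% n)%N).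
Definition cmul (k : int) (z : code) : code := (k * z.1, k * z.2).
(** Factors up to 6 in absolute value suffice, since [z] is taken of norm at most 6. *)
Definition multiple (r z : code) : bool :=
  has (fun k => z == cmul k r) [:: 0; 1; -1; 2; -2; 3; -3; 4; -4; 5; -5; 6; -6].
Definition pat_line (r : code) : pattern :=
  (tri (fun s t => multiple r (s%:Z, t%:Z)), tri (fun s t => multiple r (s%:Z, - t%:Z))).

Definition ball : seq code :=
  [seq z <- [seq (s, t) | s <- [seq i%:Z - 6 | i <- iota 0 13],
                          t <- [seq i%:Z - 6 | i <- iota 0 13]] | (cnorm z <= 6)%N].
(** Signs and the order of the pair are free, so a <= b <= n/2 may be assumed; the gcd condition
    says that a and b generate Z/n. *)
Definition residues n : seq (nat * nat) :=
  [seq q <- [seq (a, b) | a <- iota 0 n./2.+1, b <- iota 0 n./2.+1] |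
     (q.1 <= q.2)%N && (gcdn (gcdn q.1 q.2) n == 1)%N].
Definition small_pats : seq pattern :=
  flatten [seq [seq pat_mod n q.1 q.2 | q <- residues n] | n <- iota 16 21].
Definition line_pats := map pat_line ball.
(** At order 15 supports {0, a, -a} are excluded, encoded as the degenerate pair b = a. *)
Definition pats15 := [seq pat_mod 15 a a | a <- iota 0 8 & coprime a 15].
Definition pat_eqb (L M : pattern) : bool :=
  all2 (all2 Bool.eqb) L.2 M.2 && all2 (all2 Bool.eqb) L.1 M.1.
(** Many residue pairs share a pattern; the costly check then runs once per pattern. *)
Fixpoint dedup (s : seq pattern) : seq pattern :=
  if s is L :: s' then
    let r := dedup s' in if has (pat_eqb L) r then r else L :: r
  else [::].

Lemma dedup_all s : all pat_ok (dedup s) -> all pat_ok s.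
Proof.
have eqbP (L M : pattern) : pat_eqb L M -> L = M.
  have e1 (s1 s2 : seq bool) : all2 Bool.eqb s1 s2 -> s1 = s2.
    elim: s1 s2 => [|x s1 IH] [|y s2] //= /andP[h /IH ->].
    by case: x y h => [] [].
  have e2 (s1 s2 : seq (seq bool)) : all2 (all2 Bool.eqb) s1 s2 -> s1 = s2.
    by elim: s1 s2 => [|x s1 IH] [|y s2] //= /andP[/e1 -> /IH ->].
  by case: L M => [L1 L2] [M1 M2] /andP[/= /e2 -> /e2 ->].
elim: s => //= L s IH; case: ifP => [/hasP[M Ms /eqbP ->] h|_ /= /andP[-> /IH]] //.
by rewrite IH // andbT; move/allP: h; apply.
Qed.

Lemma small_pats_ok : all pat_ok small_pats.
Proof. by apply: dedup_all; vm_compute. Qed.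

Lemma line_pats_ok : all pat_ok line_pats.
Proof. by apply: dedup_all; vm_compute. Qed.

Lemma pats15_ok : all pat_ok pats15.
Proof. by vm_compute. Qed.

Lemma mulrn_ord_eq0 n (a : 'I_n.+1) k : val (a *+ k) = ((k * a) %% n.+1)%N.
Proof. by rewrite Zp_mulrn /= mulnC. Qed.

Lemma pat_of_ord n (a b : 'I_n.+1) : pat_of a b = pat_mod n.+1 a b.
Proof.
congr (_, _); apply: eq_tri => s t _; rewrite -val_eqE /= !mulrn_ord_eq0 //.
by rewrite modnDm.
Qed.

Lemma mem_ball z : (z \in ball) = (cnorm z <= 6)%N.
Proof.
rewrite mem_filter; have [z6|//] := boolP (cnorm z <= 6)%N; rewrite andTb.
have mem (i : int) : (`|i| <= 6)%N -> i \in [seq j%:Z - 6 | j <- iota 0 13].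
  move=> i6; apply/mapP; exists (absz (i + 6)%R); rewrite ?mem_iota; first by lia.
  by rewrite gez0_abs ?addrK //; lia.
have [z1 z2] := (leq_trans (leq_addr _ _) z6, leq_trans (leq_addl _ _) z6).
by rewrite [z]surjective_pairing; apply: (allpairs_f pair); apply: mem.
Qed.

(* A Euclidean step inside the ball: of two parallel codes either one divides the
   other or a combination is shorter. *)
Lemma ball_euclid : all (fun r => all (fun z =>
   if (r.1 * z.2 - z.1 * r.2 == 0) then
     if r == (0, 0) then true else
     multiple r z || has (fun i => has (fun j => let w := cadd (cmul i r) (cmul j z) in
       (w != (0, 0)) && (cnorm w < cnorm r)%N) [:: 0; 1; -1; 2; -2; 3; -3; 4; -4; 5; -5; 6; -6])
       [:: 0; 1; -1; 2; -2; 3; -3; 4; -4; 5; -5; 6; -6]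
   else true) ball) ball.
Proof. by vm_compute. Qed.

Lemma one_mulz_eq0 n (D : int) : (inZp 1 : 'I_n.+1) *~ D = 0 -> (`|D| <= n)%N -> D = 0.
Proof.
have nat0 d : (inZp 1 : 'I_n.+1) *+ d = 0 -> (d <= n)%N -> d = 0%N.
  rewrite Zp_mulrn => /(congr1 val) /=; rewrite modnMml mul1n => h dn.
  by move: h; rewrite modn_small.
case: D => d /=; first by move=> h dn; rewrite (nat0 _ h dn).
by rewrite NegzE mulrNz => /eqP; rewrite oppr_eq0 => /eqP h dn; have := nat0 _ h dn.
Qed.

(** The determinant of two relations annihilates a and b, hence also the generator 1 = [cval a b u].
    Its absolute value is at most the product of the norms, so at most 36 <= n, and it must
    vanish. *)
Lemma parallel_relations n (a b : 'I_n.+1) u r z : (36 <= n)%N ->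
  cval a b u = inZp 1 -> (cnorm r <= 6)%N -> (cnorm z <= 6)%N ->
  cval a b r = 0 -> cval a b z = 0 -> r.1 * z.2 - z.1 * r.2 = 0.
Proof.
move=> n36 u1 r6 z6 r0 z0; apply: (@one_mulz_eq0 n); last first.
  move: r6 z6; rewrite /cnorm; case: r z {r0 z0} => r1 r2 [z1 z2] /= r6 z6; nia.
have ra : a *~ r.1 = - (b *~ r.2) by apply/eqP; rewrite -addr_eq0; apply/eqP.
have za : a *~ z.1 = - (b *~ z.2) by apply/eqP; rewrite -addr_eq0; apply/eqP.
have rb : b *~ r.2 = - (a *~ r.1) by rewrite ra opprK.
have zb : b *~ z.2 = - (a *~ z.1) by rewrite za opprK.
have aD : a *~ (r.1 * z.2 - z.1 * r.2) = 0.
  by rewrite mulrzBr !mulrzA ra za !mulNrz -!mulrzA [z.2 * _]mulrC subrr.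
have bD : b *~ (r.1 * z.2 - z.1 * r.2) = 0.
  rewrite mulrzBr [r.1 * _]mulrC [z.1 * _]mulrC !mulrzA rb zb !mulNrz -!mulrzA.
  by rewrite [r.1 * _]mulrC subrr.
rewrite -u1 /cval mulrzDl -!mulrzA ![u.1 * _]mulrC ![u.2 * _]mulrC !mulrzA aD bD.
by rewrite !mul0rz addr0.
Qed.

(** Take for [r] a shortest nonzero relation in the ball, or (0, 0) if there is none. A relation
    that is not a multiple of [r] would yield a shorter one by [ball_euclid]. *)
Lemma line_pattern n (a b : 'I_n.+1) u : (36 <= n)%N -> cval a b u = inZp 1 ->
  exists2 r, r \in ball & pat_of a b = pat_line r.
Proof.
move=> n36 u1.
have [r rB rP] : exists2 r, r \in ball &
    forall z, z \in ball -> (cval a b z == 0) = multiple r z.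
  pose K := [pred z | (cval a b z == 0) && (z != (0, 0))].
  pose Q m := has (fun z => K z && (cnorm z == m)) ball.
  have [/hasP[v vB Kv]|/hasPn noK] := boolP (has K ball); last first.
    exists (0, 0) => [//|z zB]; have := noK _ zB; rewrite /= negb_and negbK.
    rewrite /multiple /cmul /= !mulr0 orbF !orbb.
    case: (z =P (0, 0)) => [->|_]; first by rewrite /cval /= !mulr0z addr0 eqxx.
    by rewrite orbF => /negPf.
  have exQ : exists m, Q m by exists (cnorm v); apply/hasP; exists v; rewrite ?Kv /=.
  case: (ex_minnP exQ) => m /hasP[r rB /andP[/andP[/eqP r0 rn0] /eqP rm]] mmin.
  exists r => // z zB; apply/idP/idP => [/eqP z0|/hasP[k _ /eqP ->]]; last first.
    by rewrite /cval /= ![k * _]mulrC !mulrzA -mulrzDl -/(cval a b r) r0 mul0rz.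
  have := allP (allP ball_euclid _ rB) _ zB.
  rewrite (parallel_relations n36 u1 _ _ r0 z0) -?mem_ball // eqxx (negPf rn0).
  case/orP => // /hasP[i _ /hasP[j _ /andP[w0 wr]]].
  set w := cadd _ _ in w0 wr.
  have : Q (cnorm w).
    apply/hasP; exists w; rewrite ?mem_ball; last first.
      rewrite eqxx andbT /= w0 andbT /w cval_add /cval /=.
      rewrite ![i * _]mulrC ![j * _]mulrC !mulrzA -!mulrzDl.
      by move: r0 z0; rewrite /cval => -> ->; rewrite !mul0rz addr0.
    by move: rB; rewrite mem_ball; apply: leq_trans; apply: ltnW.
  by move/mmin; rewrite -rm leqNgt wr.
exists r => //; congr (_, _); apply: eq_tri => s t st; rewrite -rP ?mem_ball /cnorm ?abszN //.
by rewrite /cval /= mulrNz subr_eq0.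
Qed.

Lemma mulrn_ord_mod n (a : 'I_n.+1) k : a *+ (k %% n.+1) = a *+ k.
Proof. by apply: val_inj; rewrite /= !mulrn_ord_eq0 modnMml. Qed.

(** * Excluding small supports of the spectrum *)

Section Lower.
Variables (R : realFieldType) (n : nat) (l : 'I_n.+1 -> R).
Hypotheses (leven : forall k, l (- k) = l k) (l0 : l 0 = 1).
Hypothesis lmax : forall k, l k <= 1.
Hypothesis lsq : \sum_k l k ^+ 2 <= \sum_k l k.
Hypothesis lconv : forall k, 0 < conv l k.

(** Let S be the subgroup generated by a and b. If S were proper, [conv_ineq] with E and T both
    equal to the complement of S would read 0 < 0, because all remaining sums of indices stay in
    S. *)
Lemma supp_generates a b : possupp l = [set 0; a; - a; b; - b] ->
  exists s t : nat, a *+ s + b *+ t = inZp 1.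
Proof.
move=> lsupp.
pose S : {set 'I_n.+1} :=
  [set g | [exists s : 'I_n.+1, [exists t : 'I_n.+1, g == a *+ s + b *+ t]]].
have memS s t : a *+ s + b *+ t \in S.
  rewrite inE; apply/existsP; exists (inZp s); apply/existsP; exists (inZp t).
  by rewrite /= !mulrn_ord_mod.
have SE g : g \in S -> exists s t : nat, g = a *+ s + b *+ t.
  by rewrite inE => /existsP[s /existsP[t /eqP ->]]; exists s, t.
have SD g h : g \in S -> h \in S -> g + h \in S.
  move=> /SE[s [t ->]] /SE[s' [t' ->]].
  by rewrite addrACA -!mulrnDr; apply: memS.
have mulN (c : 'I_n.+1) : c *+ n = - c.
  apply/eqP; rewrite -addr_eq0 -mulrSr -val_eqE /= mulrn_ord_eq0.
  by rewrite modnMr.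
have PS g : g \in possupp l -> g \in S.
  rewrite lsupp !in_setU !in_set1 -!orbA => /or4P[|||/orP[]] /eqP ->.
  - by have := memS 0%N 0%N; rewrite !mulr0n addr0.
  - by have := memS 1%N 0%N; rewrite mulr0n addr0.
  - by have := memS n 0%N; rewrite mulr0n addr0 mulN.
  - by have := memS 0%N 1%N; rewrite mulr0n add0r.
  - by have := memS 0%N n; rewrite mulr0n add0r mulN.
have [|out1] := boolP (inZp 1 \in S).
  by move/SE => [s [t ->]]; exists s, t.
have S0 : ~: S != set0 by apply/set0Pn; exists (inZp 1); rewrite in_setC.
have disj : [disjoint ~: S & possupp l].
  apply/pred0P => g /=; rewrite in_setC.
  by case: (boolP (g \in possupp l)) => [/PS ->|]; rewrite ?andbF.
have mass := mass1 (rel_pat_of a b) leven l0 lmax lsq lsupp.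
have := conv_ineq l0 mass lconv S0 (subxx _) disj.
have inS j : j \in ~: (possupp l :|: ~: S) -> j \in S.
  by rewrite in_setC in_setU negb_or in_setC negbK => /andP[].
rewrite !big1 ?mulr0 ?subr0 ?addr0 ?ltxx // => i iP; apply: big1 => j jP;
  by rewrite in_setC SD ?mulr0 //; auto.
Qed.

Lemma lower_half a : exists2 c : 'I_n.+1, (val c <= n.+1./2)%N & c = a \/ c = - a.
Proof.
have [h|h] := leqP a n.+1./2; first by exists a; auto.
exists (- a); last by right.
have := ltn_ord a; rewrite /= modn_small; lia.
Qed.

Lemma supp_size a b : (15 <= n)%N -> possupp l <> [set 0; a; - a; b; - b].
Proof.
move=> n15.
wlog [ah bh] : a b / (val a <= n.+1./2)%N /\ (val b <= n.+1./2)%N.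
  move=> W; have [c ch ca] := lower_half a; have [d dh db] := lower_half b.
  move=> lsupp; apply: (W c d) => //; rewrite lsupp; apply/setP => g; rewrite !inE.
  by case: ca db => -> [] ->; rewrite ?opprK; do ![case: eqP => _ //=].
wlog ab : a b ah bh / (val a <= val b)%N.
  move=> W lsupp; have [ab|ba] := leqP a b; first exact: (W a b).
  apply: (W b a) => //; first exact: ltnW.
  by rewrite lsupp; apply/setP => g; rewrite !inE; do ![case: eqP => _ //=].
move=> lsupp; have [s [t st]] := supp_generates lsupp.
have G14 : (13 < #|'I_n.+1|)%N by rewrite card_ord; lia.
apply: (pat_sound leven l0 lmax lsq lconv G14 lsupp).
(* The order is n + 1: from 37 on the relations lie on one line, and the orders 16 to 36 are covered
   by [small_pats]. *)
have [n36|n36] := leqP 36 n.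
  have [r rB ->] := line_pattern n36 (st : cval a b (s%:Z, t%:Z) = _).
  by apply: (allP line_pats_ok); apply: map_f.
apply: (allP small_pats_ok); rewrite pat_of_ord; apply/flatten_mapP.
exists n.+1; first by rewrite mem_iota; lia.
apply: (map_f (fun q : nat * nat => pat_mod n.+1 q.1 q.2) (x := (val a, val b))).
rewrite mem_filter; apply/andP; split; last first.
  by apply: (allpairs_f pair); rewrite mem_iota; lia.
(* The common divisor g divides s a + t b, which is 1 modulo n + 1, and it divides n + 1. *)
rewrite /= ab /= -dvdn1; set g := gcdn _ _.
have gn : (g %| n.+1)%N by apply: dvdn_gcdr.
have ga : (g %| a)%N by apply: dvdn_trans (dvdn_gcdl _ _) (dvdn_gcdl _ _).
have gb : (g %| b)%N by apply: dvdn_trans (dvdn_gcdl _ _) (dvdn_gcdr _ _).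
have := congr1 val st; rewrite /= !mulrn_ord_eq0 modnDm [(1 %% _)%N]modn_small; last by lia.
move=> e; rewrite -e; have := dvdn_add (dvdn_mull s ga) (dvdn_mull t gb).
by rewrite [X in (g %| X)%N -> _](divn_eq _ n.+1) dvdn_addr // dvdn_mull.
Qed.

Lemma supp_size15 a : n = 14%N -> possupp l <> [set 0; a; - a].
Proof.
move=> n14.
wlog ah : a / (val a <= n.+1./2)%N.
  move=> W; have [c ch ca] := lower_half a.
  move=> lsupp; apply: (W c) => //; rewrite lsupp; apply/setP => g; rewrite !inE.
  by case: ca => ->; rewrite ?opprK; do ![case: eqP => _ //=].
move=> lsupp0.
have lsupp : possupp l = [set 0; a; - a; a; - a].
  by rewrite lsupp0; apply/setP => g; rewrite !inE; do ![case: eqP => _ //=].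
have [s [t st]] := supp_generates lsupp.
have G14 : (13 < #|'I_n.+1|)%N by rewrite card_ord n14.
apply: (pat_sound leven l0 lmax lsq lconv G14 lsupp).
apply: (allP pats15_ok); rewrite pat_of_ord.
have := congr1 val st; rewrite -mulrnDr /= mulrn_ord_eq0 => e.
have {}ah : (nat_of_ord a <= n.+1./2)%N := ah.
move: (nat_of_ord a) ah e => c; rewrite n14 => ch e.
apply: (map_f (fun a => pat_mod 15 a a)); rewrite mem_filter mem_iota.
apply/andP; split; last by move: ch; rewrite /=; lia.
rewrite /coprime -dvdn1; have := dvdn_mull (s + t)%N (dvdn_gcdl c 15).
by rewrite [X in (_ %| X)%N -> _](divn_eq _ 15) dvdn_addr ?e // dvdn_mull // dvdn_gcdr.
Qed.

End Lower.

(** * Symmetric sets *)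

Lemma val_oppz n (a : 'I_n.+1) : (0 < val a)%N -> val (- a) = (n.+1 - val a)%N.
Proof. by move=> /= a0; rewrite modn_small //; have := ltn_ord a; lia. Qed.

Section SymmetricSet.
Variables (n : nat) (P : {set 'I_n.+1}).
Hypotheses (P0 : 0 \in P) (PN : forall k, k \in P -> - k \in P).

(** Representatives of the nonzero pairs {k, -k}. The two sets differ only in the possible element
    of order 2, which is its own negative. *)
Definition half_set := [set k in P | (0 < val k)%N && (val k + val k <= n.+1)%N].
Definition strict_half_set := [set k in P | (0 < val k)%N && (val k + val k < n.+1)%N].

Lemma symmetricE : P = 0 |: (half_set :|: -%R @: strict_half_set).
Proof.
apply/setP => k; rewrite in_setU1 in_setU; apply/idP/idP => [kP|].
  have [//|k0] := eqVneq k 0.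
  have vk : (0 < val k)%N by move: k0; rewrite -val_eqE /=; lia.
  have [h|h] := leqP (val k + val k) n.+1; first by rewrite inE kP vk h.
  apply/orP; right; apply/orP; right; apply/imsetP; exists (- k); rewrite ?opprK //.
  have := val_oppz vk; rewrite inE PN // => ->.
  by move: h vk (ltn_ord k) => /=; move: (nat_of_ord k) => m; lia.
case/orP => [/eqP -> //|/orP[|/imsetP[q]]]; first by rewrite inE => /andP[].
by rewrite inE => /andP[qP _] ->; apply: PN.
Qed.

Lemma card_symmetric : #|P| = (#|half_set| + #|strict_half_set|).+1.
Proof.
rewrite {1}symmetricE cardsU1 cardsU card_imset; last exact: oppr_inj.
rewrite disjoint_setI0 ?cards0 ?subn0; last first.
  apply/pred0P => k /=; apply/negP => /andP[]; rewrite inE => /and3P[_ k0 kn].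
  move=> /imsetP[q]; rewrite inE => /and3P[_ q0 qn] kq.
  by move: kn qn; rewrite kq val_oppz //=; move: (nat_of_ord q) => m; lia.
rewrite in_setU negb_or [0 \in half_set]inE /= andbF /=.
case: imsetP => // -[q]; rewrite inE => /and3P[_ q0 _] /esym /eqP.
by rewrite oppr_eq0 => /eqP q00; move: q0; rewrite q00.
Qed.

Lemma symmetric_card_odd : odd n.+1 -> odd #|P|.
Proof.
move=> on; rewrite card_symmetric (_ : half_set = strict_half_set) ?addnn /= ?odd_double //.
apply/setP => k; rewrite !inE; congr [&& _, _ & _].
by move: on; move: (val k) => m; lia.
Qed.

Lemma card_half_set : (#|half_set| <= #|strict_half_set|.+1)%N.
Proof.
pose M := [set k : 'I_n.+1 | val k + val k == n.+1]%N.
have M1 : (#|M| <= 1)%N.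
  apply/card_le1_eqP => x y; rewrite !inE => /eqP hx /eqP hy; apply: val_inj.
  by move: hx hy; move: (val x) (val y) => m m'; lia.
have : half_set \subset strict_half_set :|: M.
  apply/subsetP => k; rewrite !inE => /and3P[-> -> /=].
  by rewrite leq_eqVlt orbC.
move/subset_leq_card/leq_trans; apply.
by apply: leq_trans (leq_card_setU _ _) _; rewrite -[leqRHS]addn1 leq_add2l.
Qed.

Lemma symmetric_sub (H : {set 'I_n.+1}) : P = 0 |: (half_set :|: -%R @: H) ->
  H \subset half_set -> forall a b, a \in P -> b \in P -> half_set \subset [set a; b] ->
  P = [set 0; a; - a; b; - b].
Proof.
move=> PE HH a b aP bP /subsetP hab; apply/setP => g; apply/idP/idP.
  rewrite PE !in_setU !in_set1 -!orbA => /or3P[/eqP ->|/hab|/imsetP[q]].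
  - by rewrite eqxx.
  - by rewrite !inE => /orP[] ->; rewrite !orbT.
  - move=> /(subsetP HH) /hab; rewrite !inE => /orP[] /eqP -> ->;
    by rewrite eqxx !orbT.
by rewrite !inE -!orbA => /or4P[|||/orP[]] /eqP -> //; apply: PN.
Qed.

Lemma strict_half_sub : strict_half_set \subset half_set.
Proof. by apply/subsetP => k; rewrite !inE => /and3P[-> -> /ltnW ->]. Qed.

(** Three representatives would include two strict ones and give six elements. With fewer than two
    representatives, b repeats a or both are 0. *)
Lemma symmetric_card5 : (#|P| <= 5)%N -> exists a b, P = [set 0; a; - a; b; - b].
Proof.
rewrite card_symmetric => P5; have h2 : (#|half_set| <= 2)%N.
  by have := card_half_set; lia.
have build := symmetric_sub symmetricE strict_half_sub.
have halfP k : k \in half_set -> k \in P by rewrite inE => /andP[].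
have [h0|[a ah]] := set_0Vmem half_set.
  by exists 0, 0; apply: build => //; rewrite h0 sub0set.
have [h1|[b]] := set_0Vmem (half_set :\ a).
  exists a, a; apply: build; rewrite ?halfP //; apply/subsetP => k kh.
  by have := in_set0 k; rewrite -h1 in_setD1 kh andbT in_set2 => /negbFE ->.
rewrite in_setD1 => /andP[ba bh]; exists a, b; apply: build; rewrite ?halfP //.
have <- // : [set a; b] = half_set.
by apply/eqP; rewrite eqEcard cards2 eq_sym ba h2 andbT; apply/subsetP => k;
  rewrite in_set2 => /orP[] /eqP ->.
Qed.

Lemma symmetric_card3 : odd n.+1 -> (#|P| <= 3)%N -> exists a, P = [set 0; a; - a].
Proof.
rewrite card_symmetric => on P3; have h1 : (#|half_set| <= 1)%N.
  by have := card_half_set; lia.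
have build := symmetric_sub symmetricE strict_half_sub.
have halfP k : k \in half_set -> k \in P by rewrite inE => /andP[].
have [a [aP ha]] : exists a, a \in P /\ half_set \subset [set a; a].
  have [h0|[a ah]] := set_0Vmem half_set; first by exists 0; rewrite h0 sub0set.
  exists a; split; first exact: halfP.
  by apply/subsetP => k kh; rewrite !inE ((card_le1_eqP h1) k a) ?eqxx.
exists a; rewrite (build a a) //; apply/setP => g; rewrite !inE -!orbA.
by do ![case: eqP => _ //=].
Qed.

End SymmetricSet.

(** * Fourier analysis on Z/n *)

Local Open Scope complex_scope.

(** In characteristic 0 the polynomial X^n - 1 is separable, so it has n distinct roots, and these
    contain a primitive one. *)
Lemma closed_prim_root (F : numClosedFieldType) n : (0 < n)%N ->
  exists w : F, n.-primitive_root w.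
Proof.
move=> n_gt0; have [r Dp] := closed_field_poly_normal ('X^n - 1 : {poly F}).
rewrite (monicP _) ?monicXnsubC // scale1r in Dp.
have rn1 : all n.-unity_root r by apply/allP=> z; rewrite -root_prod_XsubC -Dp.
have sz_r : (n < (size r).+1)%N by rewrite -(size_prod_XsubC r id) -Dp size_XnsubC.
have [|z] := hasP (has_prim_root n_gt0 rn1 _ sz_r); last by exists z.
by rewrite -separable_prod_XsubC -Dp separable_Xn_sub_1 // pnatr_eq0 -lt0n.
Qed.

Lemma char_poly_conj (F : fieldType) n (A B P : 'M[F]_n) :
  P \in unitmx -> A *m P = P *m B -> char_poly A = char_poly B.
Proof.
move=> Pu AP; pose Q := map_mx polyC P.
have Q0 : \det Q != 0 by rewrite det_map_mx polyC_eq0 -unitfE -unitmxE.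
apply: (mulIf Q0); rewrite /char_poly -det_mulmx mulrC -det_mulmx; congr (\det _).
rewrite /char_poly_mx mulmxBl mulmxBr -!map_mxM AP; congr (_ - _).
by rewrite mul_scalar_mx mul_mx_scalar.
Qed.

Lemma sum_count_mem (T : eqType) (P : pred T) (r s : seq T) :
  uniq r -> {subset s <= r} ->
  (\sum_(x <- r | P x) count_mem x s = count P s)%N.
Proof.
move=> ur; elim: s => [|y s IH] sr /=; first by rewrite big1.
rewrite big_split /= IH; last by move=> z zs; apply: sr; rewrite in_cons zs orbT.
congr addn; have yr : y \in r by apply: sr; rewrite mem_head.
rewrite big_mkcond /= (bigD1_seq y) //= eqxx big1 ?addn0; first by case: (P y).
by move=> x xy; rewrite eq_sym (negPf xy); case: (P x).
Qed.

Lemma npos_split (R : realType) n (A : 'M[R]_n) (l : 'I_n -> R) :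
  char_poly A = \prod_k ('X - (l k)%:P) -> npos A = #|[set k | 0 < l k]|.
Proof.
move=> cA; pose s := [seq l k | k <- enum 'I_n].
have cs : char_poly A = \prod_(y <- s) ('X - y%:P) by rewrite cA big_map big_enum.
have p0 : char_poly A != 0 by rewrite monic_neq0 // char_poly_monic.
rewrite /npos; under eq_bigr => x _ do rewrite cs mu_prod_XsubC.
rewrite sum_count_mem; first 1 last.
- exact: uniq_roots.
- move=> y ys; have := roots_on_rootsR p0 y; rewrite in_itv /= => <-.
  by rewrite cs root_prod_XsubC.
by rewrite count_map -sum1_count -sum1_card big_enum_cond; apply: eq_bigl => k; rewrite inE.
Qed.

Section Fourier.
Variables (R : realType) (n : nat) (w : R[i]).
Notation N := n.+1.
Hypothesis wP : N.-primitive_root w.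
Implicit Types (f g : 'I_N -> R) (i j k : 'I_N).

Definition chi j k : R[i] := w ^+ (j * k).

Lemma chiC j k : chi j k = chi k j. Proof. by rewrite /chi mulnC. Qed.

Lemma chiDr j k k' : chi j (k + k') = chi j k * chi j k'.
Proof.
by rewrite /chi -exprD -mulnDr -(prim_expr_mod wP) /= modnMmr (prim_expr_mod wP).
Qed.

Lemma chiDl j j' k : chi (j + j') k = chi j k * chi j' k.
Proof. by rewrite chiC chiDr !(chiC k). Qed.

Lemma chi0r j : chi j 0 = 1. Proof. by rewrite /chi /= muln0. Qed.

Lemma chi0l k : chi 0 k = 1. Proof. by rewrite chiC chi0r. Qed.

Lemma mulcJ (z : R[i]) : z * z^* = (complex.Re z ^+ 2 + complex.Im z ^+ 2)%:C.
Proof. by case: z => a b; apply/eqP; rewrite eq_complex /=; apply/andP; split; apply/eqP; ring. Qed.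

Lemma w_conj : w * w^* = 1.
Proof.
have : `|w| ^+ N = 1 by rewrite -normrX (prim_expr_order wP) normr1.
move/eqP; rewrite pexpr_eq1 // => /eqP nw.
by rewrite mulcJ add_Re2_Im2 nw expr1n.
Qed.

Lemma chi_conj j k : (chi j k)^* = chi (- j) k.
Proof.
have e1 : chi j k * (chi j k)^* = 1.
  by rewrite /chi rmorphXn -exprMn w_conj expr1n.
have e2 : chi j k * chi (- j) k = 1 by rewrite -chiDl subrr chi0l.
have u : chi j k != 0 by apply/eqP => c0; move: e2; rewrite c0 mul0r => /esym/eqP; rewrite oner_eq0.
by apply: (mulfI u); rewrite e1 e2.
Qed.

Lemma chiNN j k : chi (- j) (- k) = chi j k.
Proof. by rewrite -chi_conj chiC -chi_conj conjcK chiC. Qed.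

Lemma Re_chi_le1 j k : complex.Re (chi j k) <= 1.
Proof.
have : chi j k * chi (- j) k = 1 by rewrite -chiDl subrr chi0l.
rewrite -chi_conj mulcJ => /(congr1 (@complex.Re R)) /= h.
have : complex.Re (chi j k) ^+ 2 <= 1 by rewrite -h lerDl sqr_ge0.
move=> h2; nra.
Qed.

Lemma sum_chi k : \sum_j chi j k = if k == 0 then N%:R else 0.
Proof.
case: eqP => [->|/eqP k0].
  by under eq_bigr do rewrite chi0r; rewrite sumr_const card_ord.
have wk : w ^+ k != 1.
  by rewrite -(prim_order_dvd wP) gtnNdvd // lt0n; move: k0; rewrite -val_eqE.
have : (w ^+ k - 1) * \sum_(j < N) (w ^+ k) ^+ j = 0.
  by rewrite -subrX1 -exprM mulnC exprM (prim_expr_order wP) expr1n subrr.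
move=> /eqP; rewrite mulf_eq0 subr_eq0 (negPf wk) /= => /eqP e.
by rewrite -[RHS]e; apply: eq_bigr => j _; rewrite /chi -exprM mulnC.
Qed.

Definition even_fun f := forall k, f (- k) = f k.
Definition hatC f k : R[i] := \sum_j (f j)%:C * chi j k.
(** For even [f] the transform is real, so taking the real part loses nothing; [hatE] records
    this. *)
Definition hat f k : R := complex.Re (hatC f k).

Lemma hatE f k : even_fun f -> (hat f k)%:C = hatC f k.
Proof.
move=> fe; have h : (hatC f k)^* = hatC f k.
  rewrite /hatC rmorph_sum (reindex_inj oppr_inj) /=; apply: eq_bigr => j _.
  rewrite rmorphM fe; congr (_ * _); first exact: conjc_real.
  by apply: etrans (chi_conj _ _) _; rewrite opprK.
move: h; rewrite /hat; case: (hatC f k) => a b [] /eqP.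
by rewrite eq_sym -subr_eq0 opprK -mulr2n mulrn_eq0 /= => /eqP ->.
Qed.

Lemma hat_even f : even_fun f -> even_fun (hat f).
Proof.
move=> fe k; apply: (@complexI R); rewrite !hatE // /hatC.
rewrite (reindex_inj oppr_inj) /=; apply: eq_bigr => j _.
by rewrite fe chiNN.
Qed.

Lemma hat_hat f k : even_fun f -> hat (hat f) k = N%:R * f k.
Proof.
move=> fe; apply: (@complexI R); rewrite hatE; last exact: hat_even.
rewrite /hatC; under eq_bigr => j _ do rewrite hatE // /hatC mulr_suml.
rewrite exchange_big /= (bigD1 (- k)) //= [X in _ + X]big1 ?addr0.
  under eq_bigr => j _ do rewrite -mulrA chiC -chiDr addNr chi0r mulr1.
  by rewrite sumr_const card_ord fe rmorphM /= rmorph_nat mulr_natl.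
move=> i ik; under eq_bigr => j _ do rewrite -mulrA chiC -chiDr.
rewrite -mulr_sumr sum_chi ifF ?mulr0 //.
by apply: contraNF ik => /eqP e; rewrite -(addrK k i) e sub0r.
Qed.

(** After expanding both transforms, orthogonality of the characters in j leaves only the diagonal
    terms b = a. *)
Lemma hat_conv f g k : even_fun f -> even_fun g ->
  \sum_j hat f j * hat g (k - j) = N%:R * hat (fun a => f a * g a) k.
Proof.
move=> fe ge; apply: (@complexI R); rewrite rmorphM /= rmorph_nat.
rewrite hatE => [|a]; last by rewrite fe ge.
rewrite rmorph_sum /=.
under eq_bigr => j _ do rewrite rmorphM /= !hatE // /hatC mulr_suml.
rewrite exchange_big /= mulr_sumr; apply: eq_bigr => a _.
under eq_bigr => j _ do rewrite mulr_sumr.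
have term j b : (f a)%:C * chi a j * ((g b)%:C * chi b (k - j)) =
    (f a)%:C * (g b)%:C * chi b k * chi j (a - b).
  by rewrite chiDr -(chiNN b (- j)) opprK (chiC j) chiDl; ring.
under eq_bigr => j _ do under eq_bigr => b _ do rewrite term.
rewrite exchange_big /= (bigD1 a) //= -mulr_sumr sum_chi subrr eqxx.
rewrite big1 ?addr0 => [|b ba]; first by rewrite rmorphM /=; ring.
by rewrite -mulr_sumr sum_chi subr_eq0 eq_sym (negPf ba) mulr0.
Qed.

Definition circ f : 'M[R]_N := \matrix_(i, j) f (j - i).

(** The character table F diagonalises every circulant over the complex numbers; it is invertible
    because F G = N I with G its conjugate. *)
Lemma char_poly_circ f : even_fun f -> char_poly (circ f) = \prod_k ('X - (hat f k)%:P).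
Proof.
move=> fe; apply: (map_poly_inj (real_complex R)).
rewrite map_char_poly rmorph_prod /=.
under [RHS]eq_bigr => k _ do rewrite rmorphB /= map_polyX map_polyC /=.
pose F : 'M[R[i]]_N := \matrix_(i, k) chi i k.
pose G : 'M[R[i]]_N := \matrix_(i, k) chi (- i) k.
pose D : 'M[R[i]]_N := diag_mx (\row_k (hat f k)%:C).
have FG : F *m G = N%:R%:M.
  apply/matrixP => i k; rewrite !mxE.
  under eq_bigr => j _ do rewrite !mxE (chiC (- j)) -(chiNN k) opprK (chiC (- k)) (chiC i) -chiDr.
  by rewrite sum_chi // subr_eq0; case: eqP; rewrite ?mulr1n ?mulr0n.
have Fu : F \in unitmx.
  have : \det F * \det G != 0 by rewrite -det_mulmx FG det_scalar expf_neq0 // pnatr_eq0.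
  by rewrite mulf_eq0 negb_or unitmxE unitfE => /andP[].
rewrite (char_poly_conj (B := D) Fu).
  rewrite char_poly_trig ?diag_mx_is_trig //.
  by apply: eq_bigr => k _; rewrite !mxE eqxx mulr1n.
apply/matrixP => i k; rewrite mul_mx_diag !mxE (hatE k fe) /hatC mulr_sumr.
rewrite (reindex_inj (addrI i)) /=; apply: eq_bigr => d _.
by rewrite !mxE addrAC subrr add0r chiDl; ring.
Qed.

End Fourier.

(** * Quadratic forms and positive definiteness of circulants *)

Section CirculantForms.
Variables (R : realType) (n : nat) (w : R[i]).
Notation N := n.+1.
Hypothesis wP : N.-primitive_root w.
Implicit Types (f g : 'I_N -> R) (i j k : 'I_N) (x : 'cV[R]_N).

Local Notation cosc := (fun j k => complex.Re (chi w j k)).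
Local Notation sinc := (fun j k => complex.Im (chi w j k)).

Lemma hat_Re f k : hat w f k = \sum_d f d * cosc d k.
Proof.
rewrite /hat /hatC (raddf_sum (@complex.Re R)); apply: eq_bigr => d _ /=.
by case: (chi w d k) => a b /=; ring.
Qed.

Lemma cos_sub i j k : cosc (i - j) k = cosc i k * cosc j k + sinc i k * sinc j k.
Proof.
rewrite /= chiDl // -chi_conj //.
by case: (chi w i k) (chi w j k) => a b [c d] /=; ring.
Qed.

Lemma hat_le0 f k : (forall j, 0 <= f j) -> hat w f k <= hat w f 0.
Proof.
move=> f0; rewrite !hat_Re; apply: ler_sum => d _; apply: ler_wpM2l => //.
by rewrite chi0r /= Re_chi_le1.
Qed.

Lemma hat0 f : hat w f 0 = \sum_d f d.
Proof. by rewrite hat_Re; apply: eq_bigr => d _; rewrite chi0r mulr1. Qed.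

Lemma le0_hat_ge0 f k : even_fun f -> (forall j, 0 <= hat w f j) -> f k <= f 0.
Proof.
move=> fe f0; have := hat_le0 k f0; rewrite !hat_hat //.
by rewrite ler_pM2l // ltr0n.
Qed.

(** Fourier inversion for [f] and the addition formula for the cosine write the circulant form as a
    weighted sum of squares, the weights being the eigenvalues. *)
Lemma hat_form f x : even_fun f ->
  N%:R * (\sum_i \sum_j x i 0 * x j 0 * f (i - j)) =
  \sum_k hat w f k * ((\sum_i x i 0 * cosc i k) ^+ 2 + (\sum_i x i 0 * sinc i k) ^+ 2).
Proof.
move=> fe; rewrite mulr_sumr.
under [RHS]eq_bigr => k _.
  rewrite !expr2 !mulr_suml -big_split /= mulr_sumr.
  over.
rewrite /= exchange_big /=; apply: eq_bigr => i _; rewrite mulr_sumr.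
under [RHS]eq_bigr => k _.
  rewrite !mulr_sumr -big_split /= mulr_sumr.
  over.
rewrite /= exchange_big /=; apply: eq_bigr => j _.
rewrite mulrCA -(hat_hat wP) // hat_Re mulr_sumr; apply: eq_bigr => k _.
by rewrite chiC cos_sub; ring.
Qed.

Lemma circ_form f x : even_fun f ->
  (x^T *m circ f *m x) 0 0 = \sum_i \sum_j x i 0 * x j 0 * f (i - j).
Proof.
move=> fe; rewrite mxE; apply: eq_bigr => i _; rewrite mxE mulr_suml.
by apply: eq_bigr => j _; rewrite !mxE; ring.
Qed.

Lemma hat_delta k : hat w (fun j => (j == 0)%:R) k = 1.
Proof.
rewrite hat_Re (bigD1 0) // (chi0l w) mul1r.
by rewrite big1 /= ?addr0 // => d /negPf ->; rewrite mul0r.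
Qed.

Lemma parseval x : N%:R * (\sum_i x i 0 ^+ 2) =
  \sum_k ((\sum_i x i 0 * cosc i k) ^+ 2 + (\sum_i x i 0 * sinc i k) ^+ 2).
Proof.
have e : even_fun (fun j : 'I_N => (j == 0)%:R : R) by move=> j; rewrite oppr_eq0.
transitivity (N%:R * (\sum_i \sum_j x i 0 * x j 0 * ((i - j) == 0)%:R)).
  congr (_ * _); apply: eq_bigr => i _; rewrite (bigD1 i) //= subrr eqxx mulr1 expr2.
  rewrite big1 ?addr0 // => j ji; rewrite subr_eq0 eq_sym (negPf ji) mulr0 //.
by rewrite (hat_form x e); apply: eq_bigr => k _; rewrite hat_delta mul1r.
Qed.

Lemma circ_sym f : even_fun f -> (circ f)^T = circ f.
Proof. by move=> fe; apply/matrixP => i j; rewrite !mxE -fe opprB. Qed.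

Lemma posdef_circ f : even_fun f -> posdef (circ f) <-> forall k, 0 < hat w f k.
Proof.
move=> fe; split=> [[_ fp] k|fp]; last first.
  split=> [|x x0]; first exact: circ_sym.
  rewrite circ_form // -(pmulr_rgt0 _ (ltr0Sn R n)) hat_form //.
  set S := fun k : 'I_N =>
    (\sum_i x i 0 * cosc i k) ^+ 2 + (\sum_i x i 0 * sinc i k) ^+ 2.
  have S0 k : 0 <= S k by rewrite addr_ge0 ?sqr_ge0.
  have : 0 < \sum_k S k.
    rewrite -parseval pmulr_rgt0 ?ltr0Sn // lt0r sumr_ge0 ?andbT; last first.
      by move=> i _; apply: sqr_ge0.
    apply: contraNN x0 => /eqP /psumr_eq0P h; apply/eqP/matrixP => i j.
    rewrite mxE ord1; apply/eqP; rewrite -sqrf_eq0 h // => m _; exact: sqr_ge0.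
  move=> /lt0r_neq0 Sn; rewrite lt0r sumr_ge0 ?andbT; last first.
    by move=> i _; apply: mulr_ge0 (ltW (fp i)) (S0 i).
  apply: contraNN Sn => /eqP /psumr_eq0P h; apply/eqP/big1 => k _.
  have /eqP : hat w f k * S k = 0 by apply: h => // i _; apply: mulr_ge0 (ltW (fp i)) (S0 i).
  by rewrite mulf_eq0 gt_eqF //= => /eqP.
(* The real part of the k-th character is an eigenvector for [hat w f k]; its entry at 0 is 1, so it
   is nonzero. *)
pose u : 'cV[R]_N := \col_i cosc i k.
have u00 : u 0 0 = 1 by rewrite mxE chi0l.
have u0 : u != 0 by apply/eqP => u0; move/eqP: u00; rewrite u0 mxE eq_sym oner_eq0.
have eu : circ f *m u = hat w f k *: u.
  apply/matrixP => i j; rewrite !mxE (reindex_inj (addrI i)) /=.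
  transitivity (complex.Re (hatC w f k * chi w i k)).
    rewrite /hatC mulr_suml (raddf_sum (@complex.Re R)); apply: eq_bigr => d _.
    rewrite !mxE [i + d]addrC addrK chiDl //=.
    by case: (chi w i k) (chi w d k) => a b [c e] /=; ring.
  by rewrite -hatE //; case: (chi w i k) => a b /=; ring.
have := fp u u0; rewrite -mulmxA eu -scalemxAr mxE pmulr_lgt0 //.
rewrite mxE (bigD1 0) //= ltr_wpDr //.
  by apply: sumr_ge0 => i _; rewrite mxE -expr2 sqr_ge0.
by rewrite mxE u00 mulr1.
Qed.

Lemma npos_circ f : even_fun f -> npos (circ f) = #|possupp (hat w f)|.
Proof. by move=> fe; apply: npos_split; apply: char_poly_circ. Qed.

End CirculantForms.

Lemma entrywise_sq_circ (R : realType) n (f : 'I_n.+1 -> R) :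
  entrywise_sq (circ f) = circ (fun k => f k * f k).
Proof. by apply/matrixP => i j; rewrite !mxE expr2. Qed.

Lemma circulant_circ (R : realType) n (f : 'I_n.+1 -> R) : circulant (circ f).
Proof.
exists (fun m => f (inord m)) => i j; rewrite mxE; congr f; apply: val_inj.
rewrite /= inordK ?ltn_mod // modnDmr addnBA //; exact: ltnW.
Qed.

Lemma circulantE (R : realType) n (A : 'M[R]_n.+1) : circulant A ->
  exists f, A = circ f.
Proof.
move=> [c cA]; exists (fun k => c (val k)); apply/matrixP => i j; rewrite mxE cA.
by rewrite /= modnDmr addnBA //; apply: ltnW.
Qed.

Lemma admissible_circ (R : realType) n (w : R[i]) (H : 'M[R]_n.+1) :
  n.+1.-primitive_root w ->
  kappa2_admissible H <->
  exists f, [/\ H = circ f, even_fun f, forall k, 0 < f k &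
    forall k, 0 < hat w (fun k => f k * f k) k].
Proof.
move=> wP; split=> [[HT /circulantE[f Hf] Hp Hpd]|[f [-> fe fp fpd]]].
  have fe : even_fun f.
    move=> k; have := congr1 (fun A : 'M_n.+1 => A 0 k) HT.
    by rewrite Hf !mxE sub0r subr0.
  exists f; split=> // [k|]; first by have := Hp 0 k; rewrite Hf mxE subr0.
  apply/posdef_circ => // [k|]; first by rewrite fe.
  by rewrite -entrywise_sq_circ -Hf.
split=> [||i j|]; first exact: circ_sym.
- exact: circulant_circ.
- by rewrite mxE.
rewrite entrywise_sq_circ; apply/(posdef_circ wP) => // k; by rewrite fe.
Qed.

(** * Lower bounds *)

Section NormalisedSpectrum.
Variables (R : realType) (n : nat) (w : R[i]) (f : 'I_n.+1 -> R).
Hypotheses (wP : n.+1.-primitive_root w) (fe : even_fun f).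
Hypotheses (f_gt0 : forall k, 0 < f k).
Hypothesis f2_gt0 : forall k, 0 < hat w (fun k => f k * f k) k.

Definition spec k : R := hat w f k / hat w f 0.

Lemma hat0_gt0 : 0 < hat w f 0.
Proof.
by rewrite hat0 (bigD1 0) //= ltr_pwDl // sumr_ge0 // => k _; apply: ltW.
Qed.

Lemma spec_even k : spec (- k) = spec k.
Proof. by rewrite /spec hat_even. Qed.

Lemma spec0 : spec 0 = 1.
Proof. by rewrite /spec divff // gt_eqF // hat0_gt0. Qed.

Lemma spec_le1 k : spec k <= 1.
Proof.
by rewrite ler_pdivrMr ?hat0_gt0 // mul1r hat_le0 // => j; apply: ltW.
Qed.

Lemma conv_spec k :
  conv spec k = n.+1%:R * hat w (fun k => f k * f k) k / hat w f 0 ^+ 2.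
Proof.
rewrite -hat_conv // mulr_suml; apply: eq_bigr => j _; rewrite /spec.
by field; rewrite gt_eqF // hat0_gt0.
Qed.

Lemma conv_spec_gt0 k : 0 < conv spec k.
Proof. by rewrite conv_spec divr_gt0 ?exprn_gt0 ?hat0_gt0 // mulr_gt0 ?ltr0Sn. Qed.

(** The square of [f] has positive transform, so [f] is maximal at 0. The left side is the
    convolution at 0, a multiple of the sum of f(k)^2 <= f(0) f(k); inversion identifies the right
    side with the same multiple of f(0) times the sum of [f]. *)
Lemma spec_sq : \sum_k spec k ^+ 2 <= \sum_k spec k.
Proof.
have f2e : even_fun (fun k => f k * f k) by move=> k; rewrite fe.
have fle k : f k <= f 0.
  have := le0_hat_ge0 wP k f2e (fun j => ltW (f2_gt0 j)).
  by rewrite /= -!expr2 ler_sqr // nnegrE ltW.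
have -> : \sum_k spec k ^+ 2 = conv spec 0.
  by apply: eq_bigr => k _; rewrite sub0r spec_even expr2.
have -> : \sum_k spec k = n.+1%:R * f 0 / hat w f 0.
  by rewrite -(hat_hat wP) // hat0 mulr_suml.
rewrite conv_spec ler_pdivrMr ?exprn_gt0 ?hat0_gt0 //.
have -> : n.+1%:R * f 0 / hat w f 0 * hat w f 0 ^+ 2 = n.+1%:R * (f 0 * hat w f 0).
  by field; rewrite gt_eqF // hat0_gt0.
rewrite ler_pM2l ?ltr0Sn // !hat0 mulr_sumr; apply: ler_sum => k _.
by rewrite ler_pM2r.
Qed.

Lemma possupp_spec : possupp spec = possupp (hat w f).
Proof.
by apply/setP => k; rewrite !inE /spec pmulr_lgt0 // invr_gt0 hat0_gt0.
Qed.

Lemma npos_spec : npos (circ f) = #|possupp spec|.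
Proof. by rewrite (npos_circ wP) // possupp_spec. Qed.

Lemma possupp_spec0 : 0 \in possupp spec.
Proof. by rewrite inE spec0. Qed.

Lemma possupp_specN k : k \in possupp spec -> - k \in possupp spec.
Proof. by rewrite !inE spec_even. Qed.

Lemma npos_circ_ge6 : (15 <= n)%N -> (6 <= npos (circ f))%N.
Proof.
move=> n15; rewrite npos_spec leqNgt ltnS; apply/negP => c5.
have [a [b]] := symmetric_card5 possupp_spec0 possupp_specN c5.
exact: supp_size spec_even spec0 spec_le1 spec_sq conv_spec_gt0 _ _ n15.
Qed.

Lemma npos_circ_odd : odd n.+1 -> odd (npos (circ f)).
Proof. by rewrite npos_spec; apply: (symmetric_card_odd possupp_spec0 possupp_specN). Qed.

Lemma npos_circ15 : n = 14%N -> (5 <= npos (circ f))%N.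
Proof.
move=> n14; have o : odd n.+1 by rewrite n14.
have := npos_circ_odd o; rewrite npos_spec => oP.
rewrite leqNgt ltnS; apply/negP => c4.
(* Parity excludes four positive eigenvalues. *)
have c3 : (#|possupp spec| <= 3)%N by move: oP c4; case: #|_| => [|[|[|[|[|]]]]].
have [a] := symmetric_card3 possupp_spec0 possupp_specN o c3.
exact: supp_size15 spec_even spec0 spec_le1 spec_sq conv_spec_gt0 _ n14.
Qed.

End NormalisedSpectrum.

Lemma prim_root_complex (R : realType) n : exists w : R[i], n.+1.-primitive_root w.
Proof. exact: closed_prim_root. Qed.

Lemma kappa2_ge (R : realType) n m :
  (forall H : 'M[R]_n, kappa2_admissible H -> m <= npos H)%N -> (m <= kappa2 R n)%N.
Proof. by move=> h; rewrite /kappa2; case: ex_minnP => k /asboolP[H [/h + <-]]. Qed.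

Lemma kappa2_le (R : realType) n (H : 'M[R]_n) :
  kappa2_admissible H -> (kappa2 R n <= npos H)%N.
Proof.
by move=> h; rewrite /kappa2; case: ex_minnP => k _; apply; apply/asboolP; exists H.
Qed.

Lemma kappa2_ge6 (R : realType) n : (16 <= n)%N -> (6 <= kappa2 R n)%N.
Proof.
case: n => // n n15; have [w wP] := prim_root_complex R n.
apply: kappa2_ge => H /(admissible_circ _ wP)[f [-> fe f0 f2]].
exact: npos_circ_ge6 f2 n15.
Qed.

Lemma kappa2_odd_ge7 (R : realType) n : odd n -> (17 <= n)%N -> (7 <= kappa2 R n)%N.
Proof.
case: n => // n on n16; have [w wP] := prim_root_complex R n.
apply: kappa2_ge => H /(admissible_circ _ wP)[f [-> fe f0 f2]].
have := npos_circ_ge6 wP fe f0 f2 (ltnW n16); rewrite leq_eqVlt => /predU1P[e|//].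
(* Exactly six positive eigenvalues would contradict the parity. *)
by have := npos_circ_odd wP fe f0 on; rewrite -e.
Qed.

Lemma kappa2_15_ge5 (R : realType) : (5 <= kappa2 R 15)%N.
Proof.
have [w wP] := prim_root_complex R 14.
apply: kappa2_ge => H /(admissible_circ _ wP)[f [-> fe f0 f2]].
exact: npos_circ15 f2 _.
Qed.

(** * Upper bounds *)

Section Autocorrelation.
Variables (R : realType) (n : nat) (g : 'I_n.+1 -> R).

(* Its transform is |hat g|^2 + 1. *)
Definition autocorr (k : 'I_n.+1) : R := \sum_i g i * g (i + k) + (k == 0)%:R.

Lemma autocorr_even : even_fun autocorr.
Proof.
move=> k; rewrite /autocorr oppr_eq0 (reindex_inj (addIr k)) /=; congr (_ + _).
by apply: eq_bigr => i _; rewrite addrK mulrC.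
Qed.

Lemma hat_autocorr_gt0 (w : R[i]) k :
  n.+1.-primitive_root w -> 0 < hat w autocorr k.
Proof.
move=> wP; rewrite hat_Re.
under eq_bigr => d _ do rewrite mulrDl.
rewrite big_split /= -[X in _ + X]hat_Re hat_delta ltr_wpDl //.
suff -> : \sum_d (\sum_i g i * g (i + d)) * complex.Re (chi w d k) =
    (\sum_i g i * complex.Re (chi w i k)) ^+ 2 +
    (\sum_i g i * complex.Im (chi w i k)) ^+ 2 by rewrite addr_ge0 ?sqr_ge0.
under eq_bigr => d _ do rewrite mulr_suml.
rewrite exchange_big !expr2 !mulr_suml -big_split; apply: eq_bigr => i _ /=.
(* The substitution d = j - i turns the sum into a product of transforms of [g], up to the cosine of
   a difference. *)
rewrite (reindex_inj (addIr (- i))) /= !mulr_sumr -big_split.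
by apply: eq_bigr => j _; rewrite /= [i + _]addrC subrK cos_sub //; ring.
Qed.

(** By inversion the transform of [f] is [autocorr], whose values are therefore the eigenvalues of
    [circ f]. The entries of [circ f] are positive because [autocorr] has positive transform. *)
Lemma kappa2_autocorr : (forall k, 0 < conv autocorr k) ->
  (kappa2 R n.+1 <= #|possupp autocorr|)%N.
Proof.
move=> cv; have [w wP] := prim_root_complex R n.
pose f k := hat w autocorr k / n.+1%:R.
have N0 : n.+1%:R != 0 :> R by rewrite pnatr_eq0.
have fe : even_fun f by move=> k; rewrite /f hat_even //; exact: autocorr_even.
have hf k : hat w f k = autocorr k.
  rewrite hat_Re; under eq_bigr => d _ do rewrite mulrAC.
  by rewrite -mulr_suml -hat_Re hat_hat ?(mulrC n.+1%:R) ?mulfK //; exact: autocorr_even.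
suff H : kappa2_admissible (circ f).
  apply: leq_trans (kappa2_le H) _; rewrite (npos_circ wP) //.
  by apply/subset_leq_card/subsetP => k; rewrite !inE hf.
apply/(admissible_circ _ wP); exists f; split=> // [k|k].
  by rewrite divr_gt0 ?ltr0Sn // hat_autocorr_gt0.
rewrite -(pmulr_rgt0 _ (ltr0Sn R n)) -hat_conv //.
by under eq_bigr => j _ do rewrite !hf; apply: cv.
Qed.

End Autocorrelation.

(* [%Z] denotes mathcomp's unary [int]; binary integers keep the check below feasible. *)
Delimit Scope Z_scope with BZ.

(** * Witnesses checked by integer computation *)

Section IntegerWitness.
Implicit Types (g a : seq Z) (F : nat -> Z).

Definition zsum m F : Z := foldr (fun i s => Z.add (F i) s) 0%BZ (iota 0 m).

Definition zcorr m g k : Z :=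
  Z.add (zsum m (fun i => Z.mul (nth 0%BZ g i) (nth 0%BZ g ((i + k) %% m)%N)))
        (if k == 0%N then 1%BZ else 0%BZ).

Definition zconv m a k : Z :=
  zsum m (fun j => Z.mul (nth 0%BZ a j) (nth 0%BZ a ((k + (m - j)) %% m)%N)).

Definition witness_ok m g p : bool :=
  let a := mkseq (zcorr m g) m in
  all (fun k => Z.ltb 0 (zconv m a k)) (iota 0 m) &&
  (count (Z.ltb 0) a <= p)%N.

Variable R : realType.
Definition ZtoR (z : Z) : R := (int_of_Z z)%:~R.

Lemma ZtoRD y z : ZtoR (Z.add y z) = ZtoR y + ZtoR z.
Proof. by rewrite /ZtoR -rmorphD /= -(rmorphD int_of_Z). Qed.

Lemma ZtoRM y z : ZtoR (Z.mul y z) = ZtoR y * ZtoR z.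
Proof. by rewrite /ZtoR -rmorphM /= -(rmorphM int_of_Z). Qed.

Lemma ZtoR_gt0 z : (0 < ZtoR z) = Z.ltb 0 z.
Proof. by rewrite ltr0z; lia. Qed.

Lemma ZtoR_sum m F : ZtoR (zsum m F) = \sum_(i < m) ZtoR (F i).
Proof.
rewrite -(big_mkord xpredT (fun i => ZtoR (F i))) /index_iota subn0 /zsum.
elim: (iota 0 m) => [|i s IH] /=; first by rewrite big_nil.
by rewrite big_cons ZtoRD IH.
Qed.

Lemma kappa2_witness n g p : witness_ok n.+1 g p -> (kappa2 R n.+1 <= p)%N.
Proof.
case/andP => /allP cv cnt; set a := mkseq _ _ in cv cnt.
pose G (i : 'I_n.+1) := ZtoR (nth 0%BZ g i).
have cE k : autocorr G k = ZtoR (zcorr n.+1 g k).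
  rewrite /autocorr /zcorr ZtoRD ZtoR_sum; congr (_ + _).
    by apply: eq_bigr => i _; rewrite ZtoRM.
  by rewrite -val_eqE /=; case: eqP.
apply: leq_trans (kappa2_autocorr (g := G) _) _.
  move=> k; have -> : conv (autocorr G) k = ZtoR (zconv n.+1 a k).
    rewrite /zconv ZtoR_sum; apply: eq_bigr => j _.
    by rewrite ZtoRM !nth_mkseq ?ltn_mod // !cE /= modnDmr.
  by rewrite ZtoR_gt0 cv // mem_iota /= add0n.
apply: leq_trans cnt; rewrite -sum1_card /a /mkseq count_map -sum1_count.
rewrite -[iota 0 n.+1]/(index_iota 0 n.+1) big_mkord; apply: eq_leq.
by apply: eq_bigl => k; rewrite inE cE ZtoR_gt0.
Qed.

Lemma kappa2_15_le : (kappa2 R 15 <= 5)%N.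
Proof.
(* The autocorrelation is positive exactly at 0, 1, 4 and their negatives. *)
apply: (@kappa2_witness _ [:: 129; 27; -2; -11; 27; -8; 4; -2; -2; 4; -8; 27; -11; -2; 27]%BZ).
by vm_compute.
Qed.

Lemma kappa2_16_le : (kappa2 R 16 <= 6)%N.
Proof.
(* The positive places are 0, 1, 3, their negatives, and 8; the last is its own negative, which
   makes the count even. *)
apply: (@kappa2_witness _ [:: 30; 4; -1; 6; -1; -1; 0; -1; 6; -1; 0; -1; -1; 6; -1; 4]%BZ).
by vm_compute.
Qed.

Lemma kappa2_17_le : (kappa2 R 17 <= 7)%N.
Proof.
apply: (@kappa2_witness _ [:: 37; 7; 5; -1; -1; -2; 7; -1; -1; -1; -1; 7; -2; -1; -1; 5; 7]%BZ).
by vm_compute.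
Qed.

Lemma kappa2_19_le : (kappa2 R 19 <= 7)%N.
Proof.
apply: (@kappa2_witness _
  [:: 39; 7; 8; -1; 0; -2; -1; 6; -1; -1; -1; -1; 6; -1; -2; 0; -1; 8; 7]%BZ).
by vm_compute.
Qed.

Lemma kappa2_21_le : (kappa2 R 21 <= 7)%N.
Proof.
apply: (@kappa2_witness _
  [:: 90; 13; 24; -2; -1; -10; -4; 24; -2; -5; 2; 2; -5; -2; 24; -4; -10; -1; -2; 24; 13]%BZ).
by vm_compute.
Qed.

End IntegerWitness.
Local Close Scope ring_scope.
Local Close Scope complex_scope.

Theorem theorem2p1 (R : realType) :
  [/\ forall n : nat, 16 <= n -> 6 <= kappa2 R n,
      forall n : nat, odd n -> 17 <= n -> 7 <= kappa2 R n,
      kappa2 R 16 = 6 /\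
        [/\ kappa2 R 17 = 7, kappa2 R 19 = 7 & kappa2 R 21 = 7],
      kappa2 R 15 = 5 &
      forall N : nat,
        (forall n : nat, N <= n -> 6 <= kappa2 R n) -> 16 <= N].
Proof.
have k15 : kappa2 R 15 = 5.
  by apply/anti_leq; rewrite kappa2_15_le kappa2_15_ge5.
split=> //; first exact: kappa2_ge6.
- exact: kappa2_odd_ge7.
- split; first by apply/anti_leq; rewrite kappa2_16_le kappa2_ge6.
  by split; apply/anti_leq;
    rewrite ?kappa2_17_le ?kappa2_19_le ?kappa2_21_le kappa2_odd_ge7.
by move=> N h; rewrite ltnNge; apply/negP => /h; rewrite k15.
Qed.
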